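(* Let $f:\widehat{\mathbb{C}}\to\widehat{\mathbb{C}}$ be a bicritical rational map of degree $n\ge2$. The invariants $X(f)$ and $Y(f)$ are both real if and only if $f$ commutes with some antiholomorphic involution $\alpha$ of $\widehat{\mathbb{C}}$. This $\alpha$ is unique if and only if $(f)$ lies off the symmetry locus.
   Context: A rational map $f:\widehat{\mathbb{C}}\to\widehat{\mathbb{C}}$ of degree $n\ge2$ is bicritical if it has exactly two critical points. Every bicritical map is conjugate by a Möbius automorphism to one of the form $z\mapsto(az^n+b)/(cz^n+d)$ with $ad-bc\ne0$; the quantities $X=bc/(ad-bc)$ and $Y=\big(a^{n+1}b^{n-1}+c^{n-1}d^{n+1}\big)/(ad-bc)^n$ depend only on the Möbius conjugacy class $(f)$. A homeomorphism $\alpha:\widehat{\mathbb{C}}\to\widehat{\mathbb{C}}$ is antiholomorphic if it has the form $\alpha(z)=\phi(\overline z)$ with $\phi$ a Möbius automorphism, and is an involution if $\alpha\circ\alpha$ is the identity. The symmetry locus is the set of all conjugacy classes $(f)$ of bicritical maps of degree $n$ which commute with some non-identity Möbius automorphism of $\widehat{\mathbb{C}}$. *)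

(* Defs.v *)
From HB Require Import structures.
From mathcomp Require Import all_boot all_order all_algebra.
From mathcomp Require Import complex.
From mathcomp Require Import boolp classical_sets functions reals.
From mathcomp Require Import topology normedtype derive.

Set Implicit Arguments.
Unset Strict Implicit.
Unset Printing Implicit Defensive.

Import Order.TTheory GRing.Theory Num.Theory.
Import numFieldNormedType.Exports.

Local Open Scope classical_set_scope.
Local Open Scope ring_scope.

(* The definitions below are meant for C = R[i] with R : realType; working with
   an abstract C gives it the topology of its norm. None is the point at
   infinity. *)
Definition sphere (C : numClosedFieldType) : Type := option C.

(* The map z |-> p(z)/q(z), meant for coprime p and q. Its value at infinity is
   the quotient of the coefficients of degree max(deg p, deg q). *)
Definition ratmap (C : numClosedFieldType) (p q : {poly C}) :
    sphere C -> sphere C := fun z =>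
  let quot (u v : C) : sphere C := if v == 0 then None else Some (u / v) in
  match z with
  | Some x => quot p.[x] q.[x]
  | None => let m := (maxn (size p) (size q)).-1 in quot p`_m q`_m
  end.

Definition rational_of_degree (C : numClosedFieldType) (n : nat)
    (f : sphere C -> sphere C) : Prop :=
  exists p q : {poly C},
    [/\ coprimep p q, maxn (size p) (size q) = n.+1 & f = ratmap p q].

(* z |-> (a z^n + b) / (c z^n + d) *)
Definition binomial_map (C : numClosedFieldType) (n : nat) (a b c d : C) :
    sphere C -> sphere C :=
  ratmap (a *: 'X^n + b%:P) (c *: 'X^n + d%:P).

Definition mobius (C : numClosedFieldType) (phi : sphere C -> sphere C) : Prop :=
  exists a b c d : C, a * d - b * c != 0 /\ phi = binomial_map 1 a b c d.

(* The local coordinate centred at w: x |-> x - w for finite w, x |-> 1/x for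
   w infinite. The values at points outside the domain of the coordinate
   (infinity, resp. 0) are irrelevant. *)
Definition coord (C : numClosedFieldType) (w x : sphere C) : C :=
  match w, x with
  | Some w0, Some x0 => x0 - w0
  | None, Some x0 => x0^-1
  | _, None => 0
  end.

(* The inverse of [coord w]. *)
Definition uncoord (C : numClosedFieldType) (w : sphere C) (t : C) : sphere C :=
  match w with
  | Some w0 => Some (w0 + t)
  | None => if t == 0 then None else Some t^-1
  end.

(* z is critical when f, read in local coordinates at z and f(z), has complex
   derivative 0. *)
Definition critical (C : numClosedFieldType) (f : sphere C -> sphere C)
    (z : sphere C) : Prop :=
  is_derive (0 : C) (1 : C) (fun t : C => coord (f z) (f (uncoord z t))) (0 : C).

Definition bicritical (C : numClosedFieldType) (n : nat)
    (f : sphere C -> sphere C) : Prop :=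
  rational_of_degree n f /\
  exists z1 z2 : sphere C, z1 <> z2 /\ critical f = [set z1; z2].

(* g = phi \o f \o phi^-1, written without the inverse *)
Definition mobius_conjugate (C : numClosedFieldType)
    (f g : sphere C -> sphere C) : Prop :=
  exists phi : sphere C -> sphere C, mobius phi /\ phi \o f = g \o phi.

Definition conj_class (C : numClosedFieldType) (f : sphere C -> sphere C) :
    set (sphere C -> sphere C) := [set g | mobius_conjugate f g].

Definition normal_forms (C : numClosedFieldType) (n : nat)
    (f : sphere C -> sphere C) : set (C * C * C * C) :=
  [set v | let: (a, b, c, d) := v in
           a * d - b * c != 0 /\ mobius_conjugate f (binomial_map n a b c d)].

(* A bicritical map of degree n has a normal form, and the invariants X and Y
   do not depend on which one is chosen. *)
Definition normal_coeffs (C : numClosedFieldType) (n : nat)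
    (f : sphere C -> sphere C) : C * C * C * C :=
  xget (0, 0, 0, 0) (normal_forms n f).

Definition invX (C : numClosedFieldType) (n : nat)
    (f : sphere C -> sphere C) : C :=
  let: (a, b, c, d) := normal_coeffs n f in b * c / (a * d - b * c).

Definition invY (C : numClosedFieldType) (n : nat)
    (f : sphere C -> sphere C) : C :=
  let: (a, b, c, d) := normal_coeffs n f in
  (a ^+ n.+1 * b ^+ n.-1 + c ^+ n.-1 * d ^+ n.+1) / (a * d - b * c) ^+ n.

Definition antiholomorphic (C : numClosedFieldType)
    (alpha : sphere C -> sphere C) : Prop :=
  exists phi : sphere C -> sphere C,
    mobius phi /\ alpha = phi \o omap (fun z : C => z^*).

Definition antiholomorphic_involution (C : numClosedFieldType)
    (alpha : sphere C -> sphere C) : Prop :=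
  antiholomorphic alpha /\ alpha \o alpha = id.

Definition commutes (T : Type) (g f : T -> T) : Prop := g \o f = f \o g.

(* A set of conjugacy classes, each being itself a set of maps. *)
Definition symmetry_locus (C : numClosedFieldType) (n : nat) :
    set (set (sphere C -> sphere C)) :=
  [set K | exists f : sphere C -> sphere C,
     [/\ bicritical n f, K = conj_class f &
         exists phi : sphere C -> sphere C,
           [/\ mobius phi, phi <> id & commutes phi f]]].

(* Main.v *)
(** Let f = p/q have degree n. Its critical points are the zeros of the Wronskian
    p'q - pq', of degree 2n - 2 when infinity is counted, and a zero of order k is
    a point of ramification k + 1 <= n. Hence if there are only two critical
    points, both are totally ramified and f = M o z^n o chi with M and chi
    Moebius; conjugation by chi gives the normal form (az^n + b)/(cz^n + d).

    0 and infinity are the only points alone in their fibre under the normal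
    form, so Moebius symmetries are z |-> lz or l/z, antiholomorphic ones are
    the same in the conjugate of z, and commutation becomes proportionality of
    coefficient vectors. When ad - bc = 1, the numbers a^(n+1) b^(n-1) and
    c^(n-1) d^(n+1) have sum Y and product (X+1)^(n+1) X^(n-1). If X and Y are
    real, either both numbers are real, which yields a symmetry with |l| = 1
    fixing 0 and infinity, or they are complex conjugate, which yields one with
    l real exchanging 0 and infinity.

    The product of two antiholomorphic symmetries is a Moebius symmetry.
    Conversely, a nontrivial Moebius symmetry group contains an involution psi,
    because a nontrivial rotation symmetry forces the form az^n or b/z^n; then
    for an antiholomorphic involution alpha, either psi alpha psi differs from
    alpha, or alpha psi is another antiholomorphic involution. *)

Require Import Defs.
From mathcomp Require Import all_boot all_order all_algebra.
From mathcomp Require Import complex.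
From mathcomp Require Import boolp classical_sets functions reals.
From mathcomp Require Import topology normedtype derive.
From mathcomp Require Import ring zify.

Set Implicit Arguments.
Unset Strict Implicit.
Unset Printing Implicit Defensive.

Import Order.TTheory GRing.Theory Num.Theory.
Import numFieldNormedType.Exports.

Local Open Scope ring_scope.

(** * Homogeneous coordinates and critical points *)

Section Sphere.
Variable C : numClosedFieldType.
Implicit Types p q : {poly C}.

(* The point with homogeneous coordinates [u : v]; [pt 0 0] is junk. *)
Definition pt (u v : C) : sphere C := if v == 0 then None else Some (u / v).

Lemma is_derive_horner p (x : C) :
  is_derive x (1 : C) (fun t : C => p.[t]) p^`().[x].
Proof.
elim/poly_ind: p => [|p r ih].
  rewrite deriv0 horner0 (_ : (fun _ => _) = cst 0); first exact: is_derive_cst.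
  by apply/funext => t; rewrite horner0.
rewrite (_ : (fun _ => _) = (fun t : C => p.[t]) * id + cst r); last first.
  by apply/funext => t; rewrite !(hornerE, fctE).
apply: is_derive_eq.
rewrite derivD derivM derivC derivX !hornerE.
by rewrite /GRing.scale /= mulr1 addrC mulrC.
Qed.

Lemma is_derive_horner_div p q (x : C) : q.[x] != 0 ->
  p^`().[x] * q.[x] = p.[x] * q^`().[x] ->
  is_derive x (1 : C) (fun t : C => p.[t] / q.[t]) 0.
Proof.
move=> qx0 W.
have dq := is_derive_horner q x.
have dq1 : derivable (fun t : C => q.[t]) x 1 by case: dq.
have dV : is_derive x (1 : C) (fun t : C => (q.[t])^-1)
    (- q.[x] ^- 2 *: q^`().[x]).
  apply: DeriveDef; first exact: derivableV.
  by rewrite deriveV//; case: dq => _ ->.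
have dp := is_derive_horner p x.
have -> : (fun t : C => p.[t] / q.[t]) =
    (fun t : C => p.[t]) * (fun t : C => (q.[t])^-1) by [].
apply: is_derive_eq; rewrite /GRing.scale /=.
have -> : p^`().[x] = p.[x] * q^`().[x] / q.[x] by rewrite -W mulfK.
by field.
Qed.

Lemma horner_near_neq0 q (x : C) : q.[x] != 0 -> \forall t \near x, q.[t] != 0.
Proof.
move=> qx0.
have /derivable1_diffP/differentiable_continuous qx :
  derivable (fun t : C => q.[t]) x 1 by case: (is_derive_horner q x).
by apply: (cvgr_neq0 _ qx).
Qed.

(** In the coordinate at the image point the map is p/q up to a constant, or q/p when the image is
    infinite, and both derivatives have numerator p'q - pq' up to sign. Working at 0 with
    polynomials lets finite points and infinity share the argument. *)
Lemma is_derive_coord_pt p q : (p.[0] != 0) || (q.[0] != 0) ->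
  p^`().[0] * q.[0] = p.[0] * q^`().[0] ->
  is_derive (0 : C) (1 : C)
    (fun t : C => Defs.coord (pt p.[0] q.[0]) (pt p.[t] q.[t])) 0.
Proof.
have [q0 p0 W|q0 _ W] := eqVneq q.[0] 0.
  rewrite orbF in p0.
  have -> : pt p.[0] q.[0] = None by rewrite /pt q0 eqxx.
  rewrite (_ : (fun _ => _) = (fun t : C => q.[t] / p.[t])); last first.
    apply/funext => t; rewrite /pt; case: eqP => [->|_] /=; first by rewrite mul0r.
    by rewrite invf_div.
  by apply: is_derive_horner_div; rewrite // mulrC -W mulrC.
have -> : pt p.[0] q.[0] = Some (p.[0] / q.[0]) by rewrite /pt ifN.
set w := p.[0] / q.[0].
(* The point is finite, and given by the quotient, only where q is nonzero, so the two functions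
   agree only near 0. *)
apply: (@near_eq_is_derive _ _ _ (fun t : C => (p.[t] / q.[t]) - w)).
  near=> t; rewrite /pt ifN //=.
  by near: t; exact: horner_near_neq0.
have := is_deriveB (is_derive_horner_div q0 W) (is_derive_cst w (0 : C) (1 : C)).
by rewrite subr0.
Unshelve. all: by end_near. Qed.

Definition wronskian p q := p^`() * q - p * q^`().

Lemma coprimep_horner p q (a : C) : coprimep p q -> (p.[a] != 0) || (q.[a] != 0).
Proof.
move=> cpq; rewrite -negb_and; apply/negP => /andP[/eqP pa qa].
by have := coprimep_root cpq (introT rootP pa); rewrite qa.
Qed.

(** Substituting X + a moves the point to 0. This direction confines the zeros of the Wronskian to
    the critical set. *)
Lemma critical_wronskian p q (a : C) : coprimep p q ->
  (wronskian p q).[a] = 0 -> critical (ratmap p q) (Some a).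
Proof.
move=> cpq; rewrite /wronskian !hornerE => /eqP; rewrite subr_eq0 => /eqP W.
have E r t : (r \Po ('X + a%:P)).[t] = r.[a + t].
  by rewrite horner_comp !hornerE addrC.
have E' r : (r \Po ('X + a%:P))^`().[0] = r^`().[a].
  by rewrite deriv_comp derivD derivX derivC addr0 mulr1 E addr0.
rewrite /critical /=.
have := @is_derive_coord_pt (p \Po ('X + a%:P)) (q \Po ('X + a%:P)).
rewrite !E !E' !addr0 => /(_ (coprimep_horner a cpq) W).
by under [X in is_derive _ _ X]eq_fun do rewrite !E.
Qed.

(* The polynomial t^n p(1/t). *)
Definition revp (n : nat) p := \poly_(i < n.+1) p`_(n - i).

Lemma horner_revp n p t : (size p <= n.+1)%N -> t != 0 ->
  (revp n p).[t] = t ^+ n * p.[t^-1].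
Proof.
move=> sp t0; rewrite horner_poly (horner_coef_wide _ sp) mulr_sumr.
rewrite (reindex_inj rev_ord_inj) /=; apply: eq_bigr => i _.
rewrite subSS subKn -1?ltnS // mulrCA; congr (_ * _).
by rewrite exprVn -expfB_cond ?(negPf t0) ?add0n // -ltnS.
Qed.

(** In the coordinate 1/z, p and q become their reversals, whose values at 0 are the coefficients of
    degree n+1 and whose derivatives at 0 are those of degree n. The second hypothesis is thus the
    vanishing of the reversed Wronskian at 0. *)
Lemma critical_infty n p q : maxn (size p) (size q) = n.+2 ->
  p`_n * q`_n.+1 = p`_n.+1 * q`_n -> critical (ratmap p q) None.
Proof.
move=> spq W.
have sp : (size p <= n.+2)%N by rewrite -spq leq_maxl.
have sq : (size q <= n.+2)%N by rewrite -spq leq_maxr.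
have E0 r : (revp n.+1 r).[0] = r`_n.+1.
  by rewrite horner_coef0 coef_poly /= subn0.
have E1 r : (revp n.+1 r)^`().[0] = r`_n.
  by rewrite horner_coef0 coef_deriv coef_poly /= subn1.
have := @is_derive_coord_pt (revp n.+1 p) (revp n.+1 q).
rewrite !E0 !E1 => D; rewrite /critical /= spq /=.
have {}D := D _ W; set F := fun _ => _ in D; set G := fun _ => _.
have -> : G = F; last first.
  (* The reversals do not both vanish at 0, since p or q has degree n+1. *)
  apply: D; rewrite -negb_and; apply/negP => /andP[/eqP p0 /eqP q0].
  have lt (r : {poly C}) : (size r <= n.+2)%N -> r`_n.+1 = 0 -> (size r <= n.+1)%N.
    move=> sr r0; rewrite leqNgt; apply/negP => sr'.
    have e : size r = n.+2 by apply/eqP; rewrite eqn_leq sr.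
    have : lead_coef r = 0 by rewrite lead_coefE e.
    by move/eqP; rewrite lead_coef_eq0 => /eqP r0'; rewrite r0' size_poly0 in e.
  have : (maxn (size p) (size q) <= n.+1)%N by rewrite geq_max !lt.
  by rewrite spq ltnn.
apply/funext => t; rewrite /F /G; congr (Defs.coord _ _).
have [->|t0] := eqVneq t 0; first by rewrite /= !E0 spq.
rewrite /= !horner_revp // /pt mulf_eq0 expf_eq0 (negPf t0) andbF /=.
by rewrite -mulf_div divff ?mul1r // expf_neq0.
Qed.

End Sphere.

(** * The Wronskian and total ramification *)

Section Wronskian.
Variable C : numClosedFieldType.
Implicit Types (p q l e r : {poly C}).

Lemma wronskian_comb p q (s t : C) r :
  wronskian (s *: p - t *: q) r = s *: wronskian p r - t *: wronskian q r.
Proof.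
by rewrite /wronskian derivB !derivZ -!mul_polyC; ring.
Qed.

Lemma wronskianpp p : wronskian p p = 0.
Proof. by rewrite /wronskian mulrC subrr. Qed.

Lemma wronskianC p q : wronskian p q = - wronskian q p.
Proof. by rewrite /wronskian; ring. Qed.

Lemma wronskian_combl p q (s t : C) :
  wronskian (s *: p - t *: q) q = s *: wronskian p q.
Proof. by rewrite wronskian_comb wronskianpp scaler0 subr0. Qed.

Lemma wronskian_combr p q (s t : C) :
  wronskian (s *: p - t *: q) p = t *: wronskian p q.
Proof.
by rewrite wronskian_comb wronskianpp scaler0 sub0r (wronskianC q) scalerN opprK.
Qed.

(** A linear dependence makes one polynomial a multiple of the other, and coprimality then leaves
    only constants. *)
Lemma coprimep_comb_neq0 p q (s t : C) :
  coprimep p q -> (1 < maxn (size p) (size q))%N ->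
  (s != 0) || (t != 0) -> s *: p - t *: q != 0.
Proof.
move=> cpq spq st; apply/eqP => /eqP; rewrite subr_eq0 => /eqP E.
have aux u v (c : C) : coprimep u v -> u = c *: v ->
    (maxn (size u) (size v) <= 1)%N.
  move=> cuv uv; move: cuv; rewrite {}uv.
  have [->|c0] := eqVneq c 0.
    by rewrite scale0r size_poly0 max0n coprime0p -size_poly_eq1 => /eqP ->.
  by rewrite coprimepZl // coprimepp size_scale // => /eqP ->.
suff : (maxn (size p) (size q) <= 1)%N by rewrite leqNgt spq.
case/orP: st => h; last rewrite maxnC.
  by apply: (aux _ _ (s^-1 * t)) => //; rewrite -scalerA -E scalerK.
apply: (aux _ _ (t^-1 * s)); first by rewrite coprimep_sym.
by rewrite -scalerA E scalerK.
Qed.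

(** For l = r (X - a)^(m+1) the Wronskian is (X - a)^m times a factor whose value at a is (m+1) r(a)
    e(a), nonzero in characteristic 0. *)
Lemma mup_wronskian l e (a : C) : l != 0 -> l.[a] = 0 -> e.[a] != 0 ->
  wronskian l e != 0 /\ (mup a (wronskian l e)).+1 = mup a l.
Proof.
move=> l0 la ea; have [m [r]] := multiplicity_XsubC l a.
rewrite l0 /= => ra El; move: la; rewrite El hornerM => /eqP.
rewrite mulf_eq0 -[r.[a] == 0]/(root r a) (negPf ra) /=.
case: m El => [|m] El; first by rewrite expr0 hornerC oner_eq0.
move=> _.
have EW : wronskian l e = (r * e *+ m.+1 + ('X - a%:P) * wronskian r e)
    * ('X - a%:P) ^+ m.
  rewrite /wronskian El derivM deriv_exp derivXsubC /= exprS; ring.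
have Wa : (r * e *+ m.+1 + ('X - a%:P) * wronskian r e).[a] != 0.
  rewrite !hornerE subrr mul0r addr0 hornerMn hornerM mulrn_eq0 /=.
  by rewrite mulf_eq0 negb_or ra ea.
have Xm k : mup a (('X - a%:P) ^+ k) = k by rewrite mup_XsubCX eqxx.
rewrite -El; split; last by rewrite EW El !mupMr // !Xm.
rewrite EW mulf_neq0 ?expf_neq0 ?polyXsubC_eq0 //.
by apply: contra_neq Wa => ->; rewrite horner0.
Qed.

(** Replacing one of p, q by the fibre polynomial through a changes the Wronskian only by a
    constant; keeping the one that does not vanish at a makes [mup_wronskian] applicable. *)
Lemma mup_wronskian_fiber p q (a : C) :
  coprimep p q -> (1 < maxn (size p) (size q))%N ->
  wronskian p q != 0 /\
  ('X - a%:P) ^+ (mup a (wronskian p q)).+1 %| q.[a] *: p - p.[a] *: q.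
Proof.
move=> cpq spq; set l := (X in _ %| X).
have pqa := coprimep_horner a cpq.
have l0 : l != 0 by rewrite /l coprimep_comb_neq0 // orbC.
have la : l.[a] = 0 by rewrite /l !hornerE mulrC subrr.
suff [c [e [c0 ea Ew]]] : exists c e,
    [/\ c != 0, e.[a] != 0 & wronskian l e = c *: wronskian p q].
  have [] := mup_wronskian l0 la ea; rewrite Ew scaler_eq0 negb_or => /andP[_ W0].
  rewrite -mul_polyC mupMr; last by rewrite /root hornerC.
  by move=> E; split; rewrite // -mup_geq // E.
case/orP: pqa => h.
  by exists p.[a], p; rewrite wronskian_combr.
by exists q.[a], q; rewrite wronskian_combl.
Qed.

Lemma size_mulX_deriv_sub p : p != 0 ->
  (size ('X * p^`() - (size p).-1%:R *: p)%R < size p)%N.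
Proof.
move=> p0; have [d Ed] : {d | size p = d.+1}.
  by exists (size p).-1; rewrite polySpred.
rewrite Ed /= ltnS; apply/leq_sizeP => j dj.
rewrite coefB coefZ coefXM coef_deriv.
case: j dj => [|j] dj /=.
  by move: dj; rewrite leqn0 => /eqP ->; rewrite mul0r subrr.
have [->|dj'] := eqVneq d j.+1; first by rewrite mulr_natl subrr.
rewrite (leq_sizeP _ _ (leqnn (size p))) ?mul0rn ?mulr0 ?subrr //.
by rewrite Ed ltn_neqAle dj'.
Qed.

Lemma size_wronskian n l e : l != 0 -> (size l <= n)%N -> size e = n.+1 ->
  (size (wronskian l e)).+1 = (n + size l)%N.
Proof.
move=> l0 ln se; have e0 : e != 0 by rewrite -size_poly_eq0 se.
pose d1 p : {poly C} := 'X * p^`() - (size p).-1%:R *: p.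
have se1 : (size (d1 e) < size e)%N := size_mulX_deriv_sub e0.
have sl1 : (size (d1 l) < size l)%N := size_mulX_deriv_sub l0.
(* The Euler operator 'X d/dX multiplies a leading term by the degree, so the
   leading term of l e survives with the factor deg l - deg e. *)
have E : 'X * wronskian l e =
    ((size l).-1%:R - n%:R) *: (l * e) + (d1 l * e - l * d1 e).
  rewrite /wronskian /d1 se /= -!mul_polyC !raddfB /= !rmorph_nat; ring.
have slp : (0 < size l)%N by rewrite lt0n size_poly_eq0.
have small (u v : {poly C}) : (size (u * v)%R <= (size u + size v).-1)%N.
  exact: size_polyMleq.
have sE : size ('X * wronskian l e) = (n + size l)%N.
  have c0 : ((size l).-1%:R - n%:R : C) != 0.
    rewrite subr_eq0 eqr_nat; apply: contraTneq ln => <-.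
    by rewrite -ltnNge prednK.
  have sle : size (((size l).-1%:R - n%:R) *: (l * e)) = (n + size l)%N.
    by rewrite size_scale // size_mul // se addnS addnC.
  rewrite E size_polyDl // sle.
  apply: (leq_ltn_trans (size_polyD _ _)); rewrite size_polyN gtn_max.
  rewrite se ltnS in se1; have := small (d1 l) e; have := small l (d1 e).
  rewrite se; move: slp se1 sl1.
  by move: (size _) (size _) (size _) (size _) (size _) => *; lia.
rewrite -sE; have [W0|W0] := eqVneq (wronskian l e) 0; last first.
  by rewrite mulrC size_mulX.
by move: sE; rewrite W0 mulr0 size_poly0; case: (size l) slp => // k; rewrite addnS.
Qed.

Lemma polyXsubC_dvdp_small n l (a : C) : l != 0 -> (size l <= n.+1)%N ->
  ('X - a%:P) ^+ n %| l -> exists2 c, c != 0 & l = c *: ('X - a%:P) ^+ n.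
Proof.
move=> l0 sl dl; have Xn0 : ('X - a%:P) ^+ n != 0.
  by rewrite expf_neq0 ?polyXsubC_eq0.
have : ('X - a%:P) ^+ n %= l.
  have := dvdp_leq l0 dl; rewrite -dvdp_size_eqp // size_exp_XsubC => nl.
  by rewrite eqn_leq nl sl.
rewrite eqp_sym => /eqpf_eq[c c0 ->]; by exists c.
Qed.

Lemma noroot_size1 p : (forall x, ~~ root p x) -> size p = 1.
Proof.
move=> pN; apply/eqP; have [//|/closed_rootP[x px]] := boolP (size p == 1).
by have := pN x; rewrite px.
Qed.

(** The counterpart at infinity of [mup_wronskian_fiber]: the terms of degree n in [l] cancel, n -
    deg l is the ramification index at infinity, and the Wronskian falls short of degree 2n - 2 by
    one less than that. *)
Lemma size_wronskian_infty n p q : coprimep p q -> (0 < n)%N ->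
  maxn (size p) (size q) = n.+1 ->
  let l := q`_n *: p - p`_n *: q in
  l != 0 /\ (size (wronskian p q)).+1 = (n + size l)%N.
Proof.
move=> cpq n0 spq l.
have sp : (size p <= n.+1)%N by rewrite -spq leq_maxl.
have sq : (size q <= n.+1)%N by rewrite -spq leq_maxr.
have pqn : (size p == n.+1) || (size q == n.+1).
  by rewrite /maxn in spq; case: ifP spq => _ ->; rewrite eqxx ?orbT.
have nz (e : {poly C}) : size e = n.+1 -> e`_n != 0.
  by move=> se; have := lead_coef_eq0 e; rewrite lead_coefE se /= => ->;
     rewrite -size_poly_eq0 se.
have l0 : l != 0.
  rewrite /l coprimep_comb_neq0 ?spq //.
  by case/orP: pqn => /eqP/nz ->; rewrite ?orbT.
have sl : (size l <= n)%N.
  apply/leq_sizeP => j; rewrite leq_eqVlt => /predU1P[<-|nj].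
    by rewrite /l coefB !coefZ mulrC subrr.
  by rewrite /l coefB !coefZ (nth_default 0 (leq_trans sq nj))
    (nth_default 0 (leq_trans sp nj)) !mulr0 subr0.
split => //; case/orP: pqn => /eqP se.
  have := size_wronskian l0 sl se.
  by rewrite /l wronskian_combr size_scale // nz.
have := size_wronskian l0 sl se.
by rewrite /l wronskian_combl size_scale // nz.
Qed.

(** A fibre concentrated at infinity has no finite zero, so its polynomial is constant; hence the
    value 1. *)
Definition base_poly (z : sphere C) : {poly C} :=
  if z is Some a then 'X - a%:P else 1.

(* Its n zeros (counted at infinity as well) form the fibre of p/q through z. *)
Definition fiber_poly n p q (z : sphere C) : {poly C} :=
  match z with
  | Some a => q.[a] *: p - p.[a] *: q
  | None => q`_n *: p - p`_n *: q
  end.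

(** The 2n - 2 zeros of the Wronskian lie at two points, each of order at most n - 1, so both orders
    are maximal. The last hypothesis excludes a zero at infinity unless infinity is [z]. *)
Lemma fiber_poly_pow n p q (a : C) (z : sphere C) :
  coprimep p q -> (0 < n)%N -> maxn (size p) (size q) = n.+1 -> Some a <> z ->
  (forall x, root (wronskian p q) x -> Some x = Some a \/ Some x = z) ->
  (z <> None -> p`_n.-1 * q`_n <> p`_n * q`_n.-1) ->
  (exists2 c, c != 0 & fiber_poly n p q (Some a) = c *: base_poly (Some a) ^+ n)
  /\ (exists2 c, c != 0 & fiber_poly n p q z = c *: base_poly z ^+ n).
Proof.
move=> cpq n0 spq az rW zinf.
have sp : (size p <= n.+1)%N by rewrite -spq leq_maxl.
have sq : (size q <= n.+1)%N by rewrite -spq leq_maxr.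
have spq1 : (1 < maxn (size p) (size q))%N by rewrite spq ltnS.
have [linf0 sW] := size_wronskian_infty cpq n0 spq.
pose linf : {poly C} := q`_n *: p - p`_n *: q.
rewrite -/linf in linf0 sW.
have fib x : fiber_poly n p q (Some x) != 0 /\
    (size (fiber_poly n p q (Some x)) <= n.+1)%N.
  split; first by rewrite /= coprimep_comb_neq0 // orbC coprimep_horner.
  rewrite (leq_trans (size_polyD _ _)) // size_polyN geq_max.
  by rewrite !(leq_trans (size_scale_leq _ _)).
have mup_le x : ((mup x (wronskian p q)).+1 <= n)%N.
  have [fib0 sfib] := fib x; have [_ /dvdp_leq] := mup_wronskian_fiber x cpq spq1.
  by rewrite size_exp_XsubC => /(_ fib0)/leq_trans/(_ sfib).
have full x : n.-1 = mup x (wronskian p q) ->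
    exists2 c, c != 0 & fiber_poly n p q (Some x) = c *: ('X - x%:P) ^+ n.
  move=> E; have [fib0 sfib] := fib x.
  have [_] := mup_wronskian_fiber x cpq spq1.
  by rewrite -E prednK // => /(polyXsubC_dvdp_small fib0 sfib).
have [W0 _] := mup_wronskian_fiber a cpq spq1.
(* Once the factor at [a] is split off, the cofactor [w] can vanish only at [z]. *)
have [k [w]] := multiplicity_XsubC (wronskian p q) a.
rewrite W0 /= => wa EW.
have Ek : k = mup a (wronskian p q) by rewrite EW mupMr // mup_XsubCX eqxx.
have w0 : w != 0 by apply: contraNneq wa => ->; rewrite root0.
have rw x : root w x -> Some x = z.
  move=> wx; have : root (wronskian p q) x by rewrite EW rootM wx.
  by case/rW => // -[xa]; rewrite -xa wx in wa.
have kn := mup_le a; rewrite -Ek in kn.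
have sXw : size (wronskian p q) = (size w + k)%N.
  by rewrite EW size_mul ?expf_neq0 ?polyXsubC_eq0 // size_exp_XsubC addnS.
case: z az rw zinf {rW} => [b|] az rw zinf.
  have [j [v]] := multiplicity_XsubC w b; rewrite w0 /= => vb Ew.
  have Ej : j = mup b (wronskian p q).
    rewrite EW mupMl ?Ew ?mupMr ?mup_XsubCX ?eqxx //.
    rewrite /root horner_exp hornerXsubC expf_neq0 //.
    by rewrite subr_eq0; apply: contra_notN az => /eqP ->.
  have jn := mup_le b; rewrite -Ej in jn.
  have sv : size v = 1.
    apply: noroot_size1 => x; apply/negP => vx.
    have [xb] : Some x = Some b by apply: rw; rewrite Ew rootM vx.
    by rewrite -xb vx in vb.
  have sw : size w = j.+1.
    rewrite Ew size_mul ?expf_neq0 ?polyXsubC_eq0 ?size_exp_XsubC ?sv ?addnS //.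
    by rewrite -size_poly_eq0 sv.
  (* Infinity is unramified, so the fibre polynomial there keeps degree n - 1. *)
  have : (n <= size linf)%N.
    rewrite leqNgt; apply/negP => sl; apply: zinf => //.
    have /leq_sizeP/(_ n.-1 (leqnn _)) : (size linf <= n.-1)%N.
      by rewrite -ltnS prednK.
    rewrite coefB !coefZ => /eqP; rewrite subr_eq0 => /eqP.
    by rewrite mulrC.
  (* The orders k and j sum to at least 2n - 2 and each is at most n - 1, so both equal n - 1. *)
  move: (size linf) sW; rewrite sXw sw => s sW ns.
  by split; apply: full; [rewrite -Ek | rewrite -Ej]; lia.
(* For [z] infinite, [w] is constant; then k + 2 = n + size [linf] with k < n forces k = n - 1 and a
   constant [linf]. *)
have sw : size w = 1.
  by apply: noroot_size1 => x; apply/negP => /rw.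
have : size linf != 0 by rewrite size_poly_eq0.
move: sW; rewrite sXw sw => sW linf_gt0.
split; first by apply: full; rewrite -Ek; lia.
have : size linf == 1 by lia.
by move=> /size_poly1P[c c0 Ec]; exists c; rewrite // expr1n alg_polyC -Ec.
Qed.

End Wronskian.

(** * Moebius and binomial maps in homogeneous coordinates *)

Section Mobius.
Variable C : numClosedFieldType.
Implicit Types (u v k a b c d : C) (z : sphere C) (n : nat).

Definition nz u v := (u != 0) || (v != 0).

Lemma pt_scale k u v : k != 0 -> pt (k * u) (k * v) = pt u v.
Proof.
by move=> k0; rewrite /pt mulf_eq0 (negPf k0) /= -mulf_div divff // mul1r.
Qed.

Lemma sphere_ptP z : exists u v, nz u v /\ z = pt u v.
Proof.
case: z => [x|]; first by exists x, 1; rewrite /nz /pt oner_neq0 orbT oner_eq0 divr1.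
by exists 1, 0; rewrite /nz /pt oner_neq0 eqxx.
Qed.

Lemma pt_eqP u v u' v' : nz u v -> nz u' v' ->
  reflect (pt u v = pt u' v') (u * v' == u' * v).
Proof.
rewrite /nz /pt; have [->|v0] := eqVneq v 0; have [->|v0'] := eqVneq v' 0.
- by rewrite !mulr0 eqxx => _ _; constructor.
- by rewrite orbF mulr0 mulf_eq0 (negPf v0') orbF => /negPf -> _; constructor.
- rewrite /= mulr0 [0 == _]eq_sym orbF mulf_eq0 (negPf v0) orbF => _ /negPf ->.
  by constructor.
- by move=> _ _; rewrite -eqr_div //; apply: (iffP eqP) => [->|[->]].
Qed.

Lemma pt_eq_scale u v u' v' : nz u v -> nz u' v' -> pt u v = pt u' v' ->
  exists2 k, k != 0 & u' = k * u /\ v' = k * v.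
Proof.
move=> h h' /(pt_eqP h h')/eqP E; case/orP: (h) => n0.
  have e : v' = u' / u * v by rewrite mulrAC -E [u * _]mulrC mulfK.
  exists (u' / u); last by rewrite divfK.
  rewrite mulf_neq0 ?invr_eq0 //; apply: contraTneq h' => u0.
  by rewrite /nz e u0 !mul0r eqxx.
have e : u' = v' / v * u by rewrite mulrAC [v' * u]mulrC E mulfK.
exists (v' / v); last by rewrite divfK.
rewrite mulf_neq0 ?invr_eq0 //; apply: contraTneq h' => v0.
by rewrite /nz e v0 !mul0r eqxx.
Qed.

Lemma nz_linear a b c d u v : a * d - b * c != 0 -> nz u v ->
  nz (a * u + b * v) (c * u + d * v).
Proof.
move=> D; apply: contraTT; rewrite /nz !negb_or !negbK => /andP[/eqP e1 /eqP e2].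
have /eqP : (a * d - b * c) * u = 0.
  transitivity (d * (a * u + b * v) - b * (c * u + d * v)); first by ring.
  by rewrite e1 e2 !mulr0 subrr.
have /eqP : (a * d - b * c) * v = 0.
  transitivity (a * (c * u + d * v) - c * (a * u + b * v)); first by ring.
  by rewrite e1 e2 !mulr0 subrr.
by rewrite !mulf_eq0 (negPf D) /= => -> ->.
Qed.

Lemma nz_exp n u v : nz u v -> nz (u ^+ n) (v ^+ n).
Proof. by case/orP => h; rewrite /nz (expf_neq0 n h) ?orbT. Qed.

(** This formula removes the case distinction at infinity from the later computations. *)
Lemma binomial_pt n a b c d u v : (0 < n)%N -> a * d - b * c != 0 -> nz u v ->
  binomial_map n a b c d (pt u v) =
  pt (a * u ^+ n + b * v ^+ n) (c * u ^+ n + d * v ^+ n).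
Proof.
move=> n0 D uv; rewrite /binomial_map {1}/pt; case: eqVneq => [v0|v0]; last first.
  rewrite -[LHS]/(pt _ _) !hornerE expr_div_n.
  have := expf_neq0 n v0; move: (u ^+ n) (v ^+ n) => U V V0.
  by rewrite -(pt_scale _ _ V0); congr pt; field.
rewrite v0 expr0n eqn0Ngt n0 !mulr0 !addr0; rewrite /nz v0 eqxx orbF in uv.
have sz (x y : C) : (size (x *: 'X^n + y%:P)%R <= n.+1)%N.
  rewrite (leq_trans (size_polyD _ _)) // geq_max.
  by rewrite (leq_trans (size_scale_leq _ _)) ?size_polyXn //
             (leq_trans (size_polyC_leq1 _)).
have cf (x y : C) : (x *: 'X^n + y%:P)`_n = x.
  by rewrite coefD coefZ coefXn coefC eqxx mulr1 eqn0Ngt n0 addr0.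
(* At infinity [ratmap] reads coefficients at the larger degree, which is n because a and c are not
   both 0. *)
have -> : ratmap (a *: 'X^n + b%:P) (c *: 'X^n + d%:P) None = pt a c.
  rewrite /=; suff -> : maxn (size (a *: 'X^n + b%:P)%R) (size (c *: 'X^n + d%:P)%R)
                = n.+1 by rewrite !cf.
  have szE (x y : C) : x != 0 -> size (x *: 'X^n + y%:P) = n.+1.
    move=> x0; apply/eqP; rewrite eqn_leq sz ltnNge.
    by apply/negP => /leq_sizeP/(_ n (leqnn _)); rewrite cf; apply/eqP.
  apply/eqP; rewrite eqn_leq geq_max !sz /= leq_max.
  have [a0|/szE ->] := eqVneq a 0; last by rewrite leqnn.
  have c0 : c != 0 by apply: contraNneq D => ->; rewrite a0 mul0r mulr0 subrr.
  by rewrite (szE c d c0) leqnn orbT.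
by rewrite ![_ * u ^+ n]mulrC pt_scale ?expf_neq0.
Qed.

Lemma binomial_mapZ n k a b c d : (0 < n)%N -> a * d - b * c != 0 -> k != 0 ->
  binomial_map n (k * a) (k * b) (k * c) (k * d) = binomial_map n a b c d.
Proof.
move=> n0 D k0; apply/funext => z; have [u [v [uv ->]]] := sphere_ptP z.
rewrite !binomial_pt //; first by rewrite -!mulrA -!mulrDr pt_scale.
have -> : k * a * (k * d) - k * b * (k * c) = k * k * (a * d - b * c) by ring.
by rewrite !mulf_neq0.
Qed.

Lemma nz01 : nz (0 : C) 1. Proof. by rewrite /nz oner_neq0 orbT. Qed.
Lemma nz10 : nz (1 : C) 0. Proof. by rewrite /nz oner_neq0. Qed.

Lemma binomial_pt0 n a b c d : (0 < n)%N -> a * d - b * c != 0 ->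
  binomial_map n a b c d (pt 0 1) = pt b d.
Proof.
move=> n0 D; rewrite binomial_pt ?nz01 //.
by rewrite expr1n expr0n eqn0Ngt n0 !mulr0 !add0r !mulr1.
Qed.

Lemma binomial_ptoo n a b c d : (0 < n)%N -> a * d - b * c != 0 ->
  binomial_map n a b c d (pt 1 0) = pt a c.
Proof.
move=> n0 D; rewrite binomial_pt ?nz10 //.
by rewrite expr1n expr0n eqn0Ngt n0 !mulr0 !addr0 !mulr1.
Qed.

Lemma nz_col1 a b c d : a * d - b * c != 0 -> nz a c.
Proof.
by move=> D; have := nz_linear D nz10; rewrite !mulr1 !mulr0 !addr0.
Qed.

Lemma nz_col2 a b c d : a * d - b * c != 0 -> nz b d.
Proof.
by move=> D; have := nz_linear D nz01; rewrite !mulr1 !mulr0 !add0r.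
Qed.

(** The images of 0 and infinity determine the two columns up to separate factors; the image of 1
    forces the factors to agree. *)
Lemma binomial_map_inj n a b c d a' b' c' d' : (0 < n)%N ->
  a * d - b * c != 0 -> a' * d' - b' * c' != 0 ->
  binomial_map n a b c d = binomial_map n a' b' c' d' ->
  exists2 k, k != 0 & [/\ a' = k * a, b' = k * b, c' = k * c & d' = k * d].
Proof.
move=> n0 D D' E.
have [k1 k10 [Eb Ed]] : exists2 k, k != 0 & b' = k * b /\ d' = k * d.
  apply: pt_eq_scale; [exact: nz_col2 D|exact: nz_col2 D'|].
  by rewrite -(binomial_pt0 n0 D) E binomial_pt0.
have [k2 k20 [Ea Ec]] : exists2 k, k != 0 & a' = k * a /\ c' = k * c.
  apply: pt_eq_scale; [exact: nz_col1 D|exact: nz_col1 D'|].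
  by rewrite -(binomial_ptoo n0 D) E binomial_ptoo.
have nz11 : nz (1 : C) 1 by rewrite /nz oner_neq0.
have := congr1 (@^~ (pt 1 1)) E; rewrite /= !binomial_pt // !expr1n !mulr1.
have l1 := nz_linear D nz11; have l1' := nz_linear D' nz11.
rewrite !mulr1 in l1 l1'; move/(pt_eqP l1 l1')/eqP.
rewrite Ea Eb Ec Ed => /eqP; rewrite -subr_eq0.
have -> : (a + b) * (k2 * c + k1 * d) - (k2 * a + k1 * b) * (c + d) =
  (k1 - k2) * (a * d - b * c) by ring.
rewrite mulf_eq0 (negPf D) orbF subr_eq0 => /eqP k12.
by exists k1; rewrite // -k12.
Qed.

Lemma binomial_comp n a b c d a' b' c' d' : (0 < n)%N ->
  a * d - b * c != 0 -> a' * d' - b' * c' != 0 ->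
  binomial_map 1 a b c d \o binomial_map n a' b' c' d' =
  binomial_map n (a * a' + b * c') (a * b' + b * d')
                 (c * a' + d * c') (c * b' + d * d').
Proof.
move=> n0 D D'; apply/funext => z; have [u [v [uv ->]]] := sphere_ptP z.
rewrite /= !binomial_pt ?nz_linear ?nz_exp //; first by congr pt; ring.
have -> : (a * a' + b * c') * (c * b' + d * d') -
  (a * b' + b * d') * (c * a' + d * c') =
  (a * d - b * c) * (a' * d' - b' * c') by ring.
by rewrite mulf_neq0.
Qed.

Lemma id_det_neq0 : (1 : C) * 1 - 0 * 0 != 0.
Proof. by rewrite mulr1 mul0r subr0 oner_neq0. Qed.

Lemma binomial_id : binomial_map 1 1 0 0 1 = @id (sphere C).
Proof.
apply/funext => z; have [u [v [uv ->]]] := sphere_ptP z.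
by rewrite (binomial_pt _ id_det_neq0 uv) // !expr1 !mul0r !mul1r add0r addr0.
Qed.

Lemma mobius_id : mobius (@id (sphere C)).
Proof.
by exists 1, 0, 0, 1; rewrite id_det_neq0 binomial_id.
Qed.

Lemma mobius_comp phi psi : mobius phi -> mobius psi ->
  mobius (phi \o psi : sphere C -> sphere C).
Proof.
move=> [a [b [c [d [D ->]]]]] [a' [b' [c' [d' [D' ->]]]]].
rewrite binomial_comp //; do 4 eexists; split; last by [].
have -> : (a * a' + b * c') * (c * b' + d * d') -
  (a * b' + b * d') * (c * a' + d * c') =
  (a * d - b * c) * (a' * d' - b' * c') by ring.
by rewrite mulf_neq0.
Qed.

Lemma mobius_inv (phi : sphere C -> sphere C) : mobius phi ->
  exists psi, [/\ mobius psi, phi \o psi = id & psi \o phi = id].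
Proof.
move=> [a [b [c [d [D ->]]]]].
have D' : d * a - (- b) * (- c) != 0 by rewrite mulrNN [d * a]mulrC.
(* The adjugate matrix: both products are the determinant times the identity. *)
exists (binomial_map 1 d (- b) (- c) a); split; first by exists d, (- b), (- c), a.
  rewrite binomial_comp // -binomial_id -(binomial_mapZ (ltn0Sn 0) id_det_neq0 D).
  by congr binomial_map; ring.
rewrite binomial_comp // -binomial_id -(binomial_mapZ (ltn0Sn 0) id_det_neq0 D).
by congr binomial_map; ring.
Qed.

Definition conj_sphere : sphere C -> sphere C := omap (fun x : C => x^*).

Lemma conj_sphereK : conj_sphere \o conj_sphere = id.
Proof. by apply/funext => -[x|] //=; rewrite conjCK. Qed.

Lemma conj_pt u v : conj_sphere (pt u v) = pt u^* v^*.
Proof.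
by rewrite /pt conjC_eq0; case: eqP => //= _; rewrite rmorphM fmorphV.
Qed.

Lemma nz_conj u v : nz u^* v^* = nz u v.
Proof. by rewrite /nz !conjC_eq0. Qed.

Lemma conj_binomial n a b c d : (0 < n)%N -> a * d - b * c != 0 ->
  a^* * d^* - b^* * c^* != 0 /\
  conj_sphere \o binomial_map n a b c d =
  binomial_map n a^* b^* c^* d^* \o conj_sphere.
Proof.
move=> n0 D; have D' : a^* * d^* - b^* * c^* != 0.
  by rewrite -!rmorphM -rmorphB conjC_eq0.
split => //; apply/funext => z; have [u [v [uv ->]]] := sphere_ptP z.
rewrite /= conj_pt !binomial_pt ?nz_conj // conj_pt.
by rewrite !rmorphD !rmorphM !rmorphXn.
Qed.

Lemma conj_mobius (phi : sphere C -> sphere C) : mobius phi ->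
  exists2 psi, mobius psi & conj_sphere \o phi = psi \o conj_sphere.
Proof.
move=> [a [b [c [d [D ->]]]]]; have [D' E] := conj_binomial (ltn0Sn 0) D.
by exists (binomial_map 1 a^* b^* c^* d^*); first by exists a^*, b^*, c^*, d^*.
Qed.

End Mobius.

(** * Conjugation to the normal form *)

Section NormalForm.
Variable C : numClosedFieldType.
Implicit Types (a : C) (z : sphere C) (n : nat).
Implicit Types (p q : {poly C}) (f : sphere C -> sphere C).

(** Two independent combinations of p and q are n-th powers of linear forms, so L f = chi^n for
    Moebius maps L and chi, with chi sending a to 0 and z to infinity. Conjugating by chi gives chi
    L^-1 applied to z^n. *)
Lemma fiber_poly_conjugate n p q a z : (0 < n)%N ->
  maxn (size p) (size q) = n.+1 -> coprimep p q -> Some a <> z ->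
  (exists2 c, c != 0 & fiber_poly n p q (Some a) = c *: base_poly (Some a) ^+ n) ->
  (exists2 c, c != 0 & fiber_poly n p q z = c *: base_poly z ^+ n) ->
  (normal_forms n (ratmap p q) !=set0)%classic.
Proof.
move=> n0 spq cpq az [c1 c10 E1] [c2 c20 E2].
have [s2 [t2 Ez]] : exists s t, fiber_poly n p q z = s *: p - t *: q.
  by case: z {az E2} => [b|]; [exists q.[b], p.[b] | exists q`_n, p`_n].
(* The form e x + h is the denominator of [chi], with e = 0 when z is infinite; h + a e is the
   determinant of [chi]. *)
have [e [h [Ba Bx Bn]]] : exists e h : C, [/\ h + a * e != 0,
    forall x, (base_poly z).[x] = e * x + h & (base_poly z ^+ n)`_n = e ^+ n].
  case: z az {E2 Ez} => [b|] az.
    exists 1, (- b); split; first by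
      rewrite mulr1 addrC subr_eq0; apply: contra_notN az => /eqP ->.
    - by move=> x; rewrite /= hornerXsubC mul1r.
    - have := monicP (monic_exp n (monicXsubC b)).
      by rewrite lead_coefE size_exp_XsubC expr1n.
  exists 0, 1; split; first by rewrite mulr0 addr0 oner_neq0.
    by move=> x; rewrite /= hornerC mul0r add0r.
  by rewrite /= expr1n coef1 expr0n.
have An : (base_poly (Some a) ^+ n)`_n = 1.
  have := monicP (monic_exp n (monicXsubC a)).
  by rewrite lead_coefE size_exp_XsubC.
rewrite {}Ez in E2; set s1 := q.[a] in E1; set t1 := p.[a] in E1.
have ev1 x : s1 * p.[x] - t1 * q.[x] = c1 * (x - a) ^+ n.
  have := congr1 (fun r => r.[x]) E1.
  by rewrite /= hornerD hornerN !hornerZ horner_exp hornerXsubC.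
have ev2 x : s2 * p.[x] - t2 * q.[x] = c2 * (e * x + h) ^+ n.
  have := congr1 (fun r => r.[x]) E2.
  by rewrite /= hornerD hornerN !hornerZ horner_exp Bx.
have evn1 : s1 * p`_n - t1 * q`_n = c1.
  by have := congr1 (fun r : {poly C} => r`_n) E1; rewrite /= coefB !coefZ An mulr1.
have evn2 : s2 * p`_n - t2 * q`_n = c2 * e ^+ n.
  by have := congr1 (fun r : {poly C} => r`_n) E2; rewrite /= coefB !coefZ Bn.
(* Up to the factor c1 c2 this determinant is the fibre polynomial through z evaluated at a. *)
have D : (s1 / c1) * (- t2 / c2) - (- t1 / c1) * (s2 / c2) != 0.
  have -> : (s1 / c1) * (- t2 / c2) - (- t1 / c1) * (s2 / c2) =
            (s2 * t1 - t2 * s1) / (c1 * c2) by field; rewrite c10 c20.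
  rewrite mulf_neq0 ?invr_eq0 ?mulf_neq0 // /s1 /t1 ev2 mulf_neq0 // expf_neq0 //.
  by rewrite addrC [e * a]mulrC.
have Dchi : 1 * h - - a * e != 0 by rewrite mul1r mulNr opprK.
pose L := binomial_map 1 (s1 / c1) (- t1 / c1) (s2 / c2) (- t2 / c2).
pose chi := binomial_map 1 1 (- a) e h.
have Lf : L \o ratmap p q = binomial_map n 1 0 0 1 \o chi.
  apply/funext => -[x|].
    rewrite -[LHS]/(L (pt p.[x] q.[x])).
    rewrite -[RHS]/(binomial_map n 1 0 0 1 (chi (Some x))) /L /chi.
    have -> : Some x = pt x 1 by rewrite /pt oner_eq0 divr1.
    have nzx : nz x 1 by rewrite /nz oner_neq0 orbT.
    rewrite (binomial_pt _ Dchi) // !(binomial_pt _ D) //; last exact: coprimep_horner.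
    rewrite (binomial_pt _ (id_det_neq0 C)) //; last first.
      by have := nz_linear Dchi nzx; rewrite !expr1.
    rewrite !expr1 !mul1r !mul0r addr0 add0r !mulr1.
    congr pt.
      transitivity ((s1 * p.[x] - t1 * q.[x]) / c1); first by field.
      by rewrite ev1 mulrC mulKf.
    transitivity ((s2 * p.[x] - t2 * q.[x]) / c2); first by field.
    by rewrite ev2 mulrC mulKf.
  have -> : (L \o ratmap p q) None = L (pt p`_n q`_n) by rewrite /= spq.
  rewrite -[RHS]/(binomial_map n 1 0 0 1 (chi None)) /L /chi.
  have nzn : nz p`_n q`_n.
    rewrite /nz -negb_and; apply: contraTN c10 => /andP[/eqP p0 /eqP q0].
    by rewrite negbK -evn1 p0 q0 !mulr0 subrr.
  have -> : None = pt (1 : C) 0 by rewrite /pt eqxx.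
  rewrite binomial_ptoo // !(binomial_pt _ D) //.
  rewrite (binomial_pt _ (id_det_neq0 C)) //; last exact: nz_col1 Dchi.
  rewrite !expr1 !mul1r !mul0r addr0 add0r expr1n; congr pt.
    transitivity ((s1 * p`_n - t1 * q`_n) / c1); first by field.
    by rewrite evn1 divff.
  transitivity ((s2 * p`_n - t2 * q`_n) / c2); first by field.
  by rewrite evn2 mulrC mulKf.
have [L' [mL' _ L'L]] : exists psi, [/\ mobius psi, L \o psi = id & psi \o L = id].
  by apply: mobius_inv; do 4 eexists; split; [exact: D|].
have mchi : mobius chi by do 4 eexists; split; [exact: Dchi|].
have [a' [b' [c' [d' [D' EM]]]]] := mobius_comp mchi mL'.
exists (a', b', c', d'); split; first exact: D'.
exists chi; split => //.
have -> : binomial_map n a' b' c' d' = (chi \o L') \o binomial_map n 1 0 0 1.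
  rewrite EM binomial_comp ?id_det_neq0 //.
  by rewrite !mulr1 !mulr0 !addr0 !add0r.
apply/funext => z'.
rewrite -[RHS]/(chi (L' ((binomial_map n 1 0 0 1 \o chi) z'))) -Lf.
exact: (congr1 chi (esym (congr1 (@^~ (ratmap p q z')) L'L))).
Qed.

Lemma bicritical_normal_form n f : (2 <= n)%N -> bicritical n f ->
  (normal_forms n f !=set0)%classic.
Proof.
case: n => [//|n] _ [[p [q [cpq spq ->]]] [z1 [z2 [z12 crit]]]].
have main a z : Some a <> z -> critical (ratmap p q) = [set Some a; z]%classic ->
    (normal_forms n.+1 (ratmap p q) !=set0)%classic.
  move=> az cr; have [] := @fiber_poly_pow _ n.+1 p q a z cpq (ltn0Sn n) spq az.
  - move=> x /rootP /(critical_wronskian cpq); rewrite cr.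
    by case=> ->; [left|right].
  - move=> zN /(critical_infty spq).
    by rewrite cr; case => // /esym.
  - exact: fiber_poly_conjugate.
(* Of two distinct points one is finite; it takes the role of [a]. *)
case: z1 z12 crit => [a|] z12 crit; first exact: main z12 crit.
case: z2 z12 crit => [b|//] z12 crit.
by apply: (main b None) => //; rewrite setUC.
Qed.

End NormalForm.

(** * Shape of the symmetries of a normal form *)

Section Symmetries.
Variable C : numClosedFieldType.
Implicit Types (a b c d mu : C) (z : sphere C) (n : nat).
Implicit Types (phi h : sphere C -> sphere C).

(** A root of 1 + x + ... + x^(n-1) serves, since this sum is n at x = 1. *)
Lemma unity_root_neq1 n : (2 <= n)%N -> exists2 w : C, w ^+ n = 1 & w != 1.
Proof.
move=> n2; pose p : {poly C} := \sum_(i < n) 'X^i.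
have sp : size p = n.
  have -> : p = \poly_(i < n) 1.
    by rewrite poly_def; apply: eq_bigr => i _; rewrite scale1r.
  by rewrite size_poly_eq // oner_neq0.
have /closed_rootP[w /rootP pw] : size p != 1 by rewrite sp gtn_eqF.
have Ep x : p.[x] = \sum_(i < n) x ^+ i.
  by rewrite horner_sum; apply: eq_bigr => i _; rewrite hornerXn.
exists w; first by apply/eqP; rewrite -subr_eq0 subrX1 -Ep pw mulr0.
apply: contra_eq_neq pw => ->; rewrite Ep.
rewrite (eq_bigr (fun=> 1)) => [|i _]; last by rewrite expr1n.
by rewrite sumr_const card_ord pnatr_eq0 -lt0n ltnW.
Qed.

(* Total ramification in a form visibly preserved by every bijection commuting
   with the map. *)
Lemma ramified_binomial n a b c d z : (2 <= n)%N -> a * d - b * c != 0 ->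
  (forall y, binomial_map n a b c d y = binomial_map n a b c d z -> y = z) <->
  z = pt 0 1 \/ z = pt 1 0.
Proof.
move=> n2 D; have n0 : (0 < n)%N by apply: leq_trans n2.
split=> [H|zE y].
  case: z H => [x|] H; last by right; rewrite /pt eqxx.
  left; rewrite /pt oner_eq0 mul0r; congr Some.
  have [w wn w1] := unity_root_neq1 n2.
  have : Some (w * x) = Some x by apply: H; rewrite /= !hornerE exprMn wn mul1r.
  move=> [] /eqP; rewrite -subr_eq0 -{2}[x]mul1r -mulrBl mulf_eq0 subr_eq0.
  by rewrite (negPf w1) /= => /eqP.
have [u [v [uv ->]]] := sphere_ptP y.
have luv := nz_linear D (nz_exp n uv).
case: zE => ->; rewrite ?binomial_pt0 ?binomial_ptoo // binomial_pt //.
  move/(pt_eqP luv (nz_col2 D)); rewrite -subr_eq0.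
  have -> : (a * u ^+ n + b * v ^+ n) * d - b * (c * u ^+ n + d * v ^+ n) =
    u ^+ n * (a * d - b * c) by ring.
  rewrite mulf_eq0 (negPf D) orbF expf_eq0 n0 /= => /eqP u0.
  by apply/(pt_eqP uv (nz01 C)); rewrite u0 !mul0r.
move/(pt_eqP luv (nz_col1 D)); rewrite -subr_eq0.
have -> : (a * u ^+ n + b * v ^+ n) * c - a * (c * u ^+ n + d * v ^+ n) =
  - v ^+ n * (a * d - b * c) by ring.
rewrite mulf_eq0 (negPf D) orbF oppr_eq0 expf_eq0 n0 /= => /eqP v0.
by apply/(pt_eqP uv (nz10 C)); rewrite v0 !mulr0.
Qed.

(** A bijection commuting with the map carries fibres to fibres. Nothing else is asked of [h], so
    Moebius and antiholomorphic symmetries are covered alike. *)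
Lemma commute_ramified n a b c d h h' z : (2 <= n)%N -> a * d - b * c != 0 ->
  h \o h' = id -> h' \o h = id -> commutes h (binomial_map n a b c d) ->
  z = pt 0 1 \/ z = pt 1 0 -> h z = pt 0 1 \/ h z = pt 1 0.
Proof.
move=> n2 D hh' h'h hg /(ramified_binomial _ n2 D) zR.
apply/(ramified_binomial _ n2 D) => y gy.
have hK x : h (h' x) = x by exact: (congr1 (@^~ x) hh').
have h'K x : h' (h x) = x by exact: (congr1 (@^~ x) h'h).
have hgE x : h (binomial_map n a b c d x) = binomial_map n a b c d (h x).
  exact: (congr1 (@^~ x) hg).
by rewrite -(hK y); congr h; apply: zR; rewrite -[LHS]h'K hgE hK gy -hgE h'K.
Qed.

Definition diag mu := binomial_map 1 mu 0 0 1.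
(** The map mu/z. The name refers to the antidiagonal matrix; the map is holomorphic. *)
Definition anti mu := binomial_map 1 0 mu 1 0.

Lemma diag_det_neq0 mu : mu != 0 -> mu * 1 - 0 * 0 != 0.
Proof. by rewrite mulr1 mul0r subr0. Qed.

Lemma anti_det_neq0 mu : mu != 0 -> 0 * 0 - mu * 1 != 0.
Proof. by rewrite mulr1 mul0r sub0r oppr_eq0. Qed.

(** The images of 0 and infinity each kill one matrix entry, and the nonzero determinant leaves a
    diagonal or antidiagonal matrix. *)
Lemma mobius_ramified phi : mobius phi ->
  (forall z, z = pt 0 1 \/ z = pt 1 0 -> phi z = pt 0 1 \/ phi z = pt 1 0) ->
  exists2 mu, mu != 0 & phi = diag mu \/ phi = anti mu.
Proof.
move=> [a [b [c [d [D ->]]]]] H.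
have n1 := ltn0Sn 0.
have bd0 : b = 0 \/ d = 0.
  have := H (pt 0 1) (or_introl erefl); rewrite binomial_pt0 //.
  case=> [/(pt_eqP (nz_col2 D) (nz01 C))|/(pt_eqP (nz_col2 D) (nz10 C))].
    by rewrite mulr1 mul0r => /eqP; left.
  by rewrite mulr0 mul1r eq_sym => /eqP; right.
have ac0 : a = 0 \/ c = 0.
  have := H (pt 1 0) (or_intror erefl); rewrite binomial_ptoo //.
  case=> [/(pt_eqP (nz_col1 D) (nz01 C))|/(pt_eqP (nz_col1 D) (nz10 C))].
    by rewrite mulr1 mul0r => /eqP; left.
  by rewrite mulr0 mul1r eq_sym => /eqP; right.
case: bd0 ac0 => E [] E'; move: D; rewrite E E' ?mul0r ?mulr0 ?subrr ?eqxx //.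
  rewrite subr0 mulf_eq0 negb_or => /andP[a0 d0].
  exists (a / d); first by rewrite mulf_neq0 ?invr_eq0.
  left; rewrite /diag -(@binomial_mapZ _ 1 d (a / d)) ?diag_det_neq0 //.
    by rewrite mulrC divfK // !mulr0 mulr1.
  by rewrite mulf_neq0 ?invr_eq0.
rewrite sub0r oppr_eq0 mulf_eq0 negb_or => /andP[b0 c0].
exists (b / c); first by rewrite mulf_neq0 ?invr_eq0.
right; rewrite /anti -(@binomial_mapZ _ 1 c 0 (b / c)) ?anti_det_neq0 //.
  by rewrite [c * (b / c)]mulrC divfK // !mulr0 mulr1.
by rewrite mulf_neq0 ?invr_eq0.
Qed.

(** Both composites are binomial maps of degree n, so they agree when their coefficients are
    proportional. Two sets of coefficients are allowed because an antiholomorphic symmetry gives a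
    semiconjugacy from the map with conjugate coefficients. *)
Lemma diag_semiconj n a b c d a' b' c' d' mu : (0 < n)%N ->
  a * d - b * c != 0 -> a' * d' - b' * c' != 0 -> mu != 0 ->
  (diag mu \o binomial_map n a b c d = binomial_map n a' b' c' d' \o diag mu) <->
  exists2 k, k != 0 & [/\ a' * mu ^+ n = k * (mu * a), b' = k * (mu * b),
                       c' * mu ^+ n = k * c & d' = k * d].
Proof.
move=> n0 D D' mu0.
have Dl : mu * a * d - mu * b * c != 0.
  by rewrite -!mulrA -mulrBr mulf_neq0.
have Dr : a' * mu ^+ n * d' - b' * (c' * mu ^+ n) != 0.
  have -> : a' * mu ^+ n * d' - b' * (c' * mu ^+ n) =
    (a' * d' - b' * c') * mu ^+ n by ring.
  by rewrite mulf_neq0 ?expf_neq0.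
have -> : diag mu \o binomial_map n a b c d = binomial_map n (mu * a) (mu * b) c d.
  by rewrite binomial_comp ?diag_det_neq0 // !mul0r !mul1r !addr0 !add0r.
have -> : binomial_map n a' b' c' d' \o diag mu =
    binomial_map n (a' * mu ^+ n) b' (c' * mu ^+ n) d'.
  apply/funext => z; have [u [v [uv ->]]] := sphere_ptP z.
  rewrite /diag /= (binomial_pt _ (diag_det_neq0 mu0)) // binomial_pt //; last first.
    by have := nz_linear (diag_det_neq0 mu0) uv; rewrite !expr1.
  by rewrite binomial_pt // !expr1 !mul0r mul1r addr0 add0r exprMn !mulrA.
split=> [/(binomial_map_inj n0 Dl Dr)//|[k k0 [-> -> -> ->]]].
by rewrite binomial_mapZ.
Qed.

Lemma anti_semiconj n a b c d a' b' c' d' mu : (0 < n)%N ->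
  a * d - b * c != 0 -> a' * d' - b' * c' != 0 -> mu != 0 ->
  (anti mu \o binomial_map n a b c d = binomial_map n a' b' c' d' \o anti mu) <->
  exists2 k, k != 0 & [/\ b' = k * (mu * c), a' * mu ^+ n = k * (mu * d),
                       d' = k * a & c' * mu ^+ n = k * b].
Proof.
move=> n0 D D' mu0.
have Dl : mu * c * b - mu * d * a != 0.
  have -> : mu * c * b - mu * d * a = - (mu * (a * d - b * c)) by ring.
  by rewrite oppr_eq0 mulf_neq0.
have Dr : b' * (c' * mu ^+ n) - a' * mu ^+ n * d' != 0.
  have -> : b' * (c' * mu ^+ n) - a' * mu ^+ n * d' =
    - ((a' * d' - b' * c') * mu ^+ n) by ring.
  by rewrite oppr_eq0 mulf_neq0 ?expf_neq0.
have -> : anti mu \o binomial_map n a b c d = binomial_map n (mu * c) (mu * d) a b.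
  by rewrite binomial_comp ?anti_det_neq0 // !mul0r !mul1r !addr0 !add0r.
have -> : binomial_map n a' b' c' d' \o anti mu =
    binomial_map n b' (a' * mu ^+ n) d' (c' * mu ^+ n).
  apply/funext => z; have [u [v [uv ->]]] := sphere_ptP z.
  rewrite /anti /= (binomial_pt _ (anti_det_neq0 mu0)) // binomial_pt //; last first.
    by have := nz_linear (anti_det_neq0 mu0) uv; rewrite !expr1.
  rewrite binomial_pt // !expr1 !mul0r mul1r addr0 add0r exprMn !mulrA.
  by congr pt; rewrite addrC.
split=> [/(binomial_map_inj n0 Dl Dr)//|[k k0 [-> -> -> ->]]].
by rewrite binomial_mapZ.
Qed.

End Symmetries.

(** * The invariants as functions of the coefficients *)

Section Invariants.
Variable C : numClosedFieldType.
Implicit Types (a b c d k l w : C) (n m : nat).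

Definition paramX a b c d := b * c / (a * d - b * c).
Definition paramY n a b c d :=
  (a ^+ n.+1 * b ^+ n.-1 + c ^+ n.-1 * d ^+ n.+1) / (a * d - b * c) ^+ n.

(* Up to the factor k, the new coefficients are those of the conjugate of the
   normal form by z |-> z / l. *)
Lemma param_twist m k l a b c d : k != 0 -> l != 0 ->
  let a' := k * l ^+ m * a in let b' := k * l^-1 * b in
  let c' := k * l ^+ m.+1 * c in let d' := k * d in
  paramX a' b' c' d' = paramX a b c d /\
  paramY m.+1 a' b' c' d' = paramY m.+1 a b c d.
Proof.
move=> k0 l0 a' b' c' d'; have lm0 : l ^+ m != 0 by rewrite expf_neq0.
have DE : a' * d' - b' * c' = k * k * l ^+ m * (a * d - b * c).
  rewrite /a' /b' /c' /d' !exprS; move: (l ^+ m) => L; by field.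
have kl0 : k * k * l ^+ m != 0 by rewrite !mulf_neq0.
split; rewrite /paramX /paramY DE.
  have -> : b' * c' = k * k * l ^+ m * (b * c).
    by rewrite /b' /c' exprS; move: (l ^+ m) => L; field.
  by rewrite -mulf_div divff // mul1r.
have -> : a' ^+ m.+2 * b' ^+ m.+1.-1 + c' ^+ m.+1.-1 * d' ^+ m.+2 =
  (k * k * l ^+ m) ^+ m.+1 * (a ^+ m.+2 * b ^+ m + c ^+ m * d ^+ m.+2).
  rewrite /a' /b' /c' /d' /= !exprS !exprMn !exprVn.
  by move: (k ^+ m) (a ^+ m) (b ^+ m) (c ^+ m) (d ^+ m) ((l ^+ m) ^+ m)
    (l ^+ m) lm0 => *; field.
by rewrite [(_ * (a * d - b * c)) ^+ _]exprMn -mulf_div divff ?expf_neq0 // mul1r.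
Qed.

(** Reversing the order of the coefficients is conjugation by 1/z. *)
Lemma param_swap n a b c d :
  paramX d c b a = paramX a b c d /\ paramY n d c b a = paramY n a b c d.
Proof.
have E : d * a - c * b = a * d - b * c by ring.
rewrite /paramX /paramY E; split; congr (_ / _); first by rewrite mulrC.
by rewrite addrC [b ^+ _ * _]mulrC [d ^+ _ * _]mulrC.
Qed.

Lemma conj_param n a b c d :
  (paramX a b c d)^* = paramX a^* b^* c^* d^* /\
  (paramY n a b c d)^* = paramY n a^* b^* c^* d^*.
Proof.
by rewrite /paramX /paramY !fmorph_div !(rmorphB, rmorphD, rmorphM, rmorphXn).
Qed.

(** The relations exhibit the conjugate coefficients as a twist of the original ones, so X and Y
    equal their conjugates. *)
Lemma diag_param_real m a b c d l k : l != 0 -> k != 0 ->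
  [/\ a * l ^+ m.+1 = k * (l * a^*), b = k * (l * b^*),
      c * l ^+ m.+1 = k * c^* & d = k * d^*] ->
  paramX a b c d \is Num.real /\ paramY m.+1 a b c d \is Num.real.
Proof.
move=> l0 k0 [Ea Eb Ec Ed]; rewrite !CrealE.
have [-> ->] := conj_param m.+1 a b c d.
have k0' : k^-1 != 0 by rewrite invr_eq0.
have [EX EY] := param_twist m a b c d k0' l0.
have -> : a^* = k^-1 * l ^+ m * a.
  by apply: (mulfI k0); apply: (mulfI l0); rewrite mulrCA -Ea exprS; field.
have -> : b^* = k^-1 * l^-1 * b by rewrite {2}Eb; field; rewrite k0 l0.
have -> : c^* = k^-1 * l ^+ m.+1 * c.
  by apply: (mulfI k0); rewrite -Ec; field.
have -> : d^* = k^-1 * d by rewrite {2}Ed mulKf.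
by rewrite EX EY !eqxx.
Qed.

(** Here the conjugate coefficients are a twist followed by a reversal. *)
Lemma anti_param_real m a b c d l k : l != 0 -> k != 0 ->
  [/\ b = k * (l * c^*), a * l ^+ m.+1 = k * (l * d^*),
      d = k * a^* & c * l ^+ m.+1 = k * b^*] ->
  paramX a b c d \is Num.real /\ paramY m.+1 a b c d \is Num.real.
Proof.
move=> l0 k0 [Eb Ea Ed Ec]; rewrite !CrealE.
have [-> ->] := conj_param m.+1 a b c d.
have k0' : k^-1 != 0 by rewrite invr_eq0.
have [EX EY] := param_twist m a b c d k0' l0.
have -> : d^* = k^-1 * l ^+ m * a.
  by apply: (mulfI k0); apply: (mulfI l0); rewrite mulrCA -Ea exprS; field.
have -> : c^* = k^-1 * l^-1 * b by rewrite Eb; field; rewrite k0 l0.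
have -> : b^* = k^-1 * l ^+ m.+1 * c.
  by apply: (mulfI k0); rewrite -Ec; field.
have -> : a^* = k^-1 * d by rewrite Ed mulKf.
set a' := k^-1 * l ^+ m * a; set b' := k^-1 * l^-1 * b.
have [-> ->] := param_swap m.+1 a' b' (k^-1 * l ^+ m.+1 * c) (k^-1 * d).
by rewrite EX EY !eqxx.
Qed.

Lemma unit_root n w : (0 < n)%N -> w * w^* = 1 ->
  exists2 l : C, l ^+ n = w & l * l^* = 1.
Proof.
move=> n0 w1; exists (n.-root w); first by rewrite rootCK.
have : (`|n.-root w| ^+ 2) ^+ n = 1.
  by rewrite exprAC -normrX rootCK // normCK.
move/eqP; rewrite pexpr_eq1 ?exprn_ge0 // => /eqP <-.
by rewrite normCK.
Qed.

(** * Solving for an antiholomorphic symmetry at determinant 1 *)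

Section Existence.
Variables (m : nat) (a b c d : C).
Hypothesis (m0 : (0 < m)%N) (D : a * d - b * c = 1).
Hypothesis (bcR : (b * c)^* = b * c).

Let Dn : a * d = 1 + b * c. Proof. by rewrite -D subrK. Qed.
Let adR : a^* * d^* = a * d.
Proof. by rewrite -rmorphM Dn rmorphD rmorph1 /= bcR. Qed.
Let bcR' : b^* * c^* = b * c. Proof. by rewrite -rmorphM. Qed.

(** If a, b or c, d are both nonzero, k and l are explicit quotients, and the relations follow from
    reality of ad, bc and the two products. Otherwise l is a root of a number of modulus 1. *)
Lemma diag_exists :
  a^* ^+ m.+2 * b^* ^+ m = a ^+ m.+2 * b ^+ m ->
  c^* ^+ m * d^* ^+ m.+2 = c ^+ m * d ^+ m.+2 ->
  exists l k, [/\ l * l^* = 1, k != 0 &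
    [/\ a * l ^+ m.+1 = k * (l * a^*), b = k * (l * b^*),
        c * l ^+ m.+1 = k * c^* & d = k * d^*]].
Proof.
move=> PR QR.
have [ab0|abN] := boolP ((a == 0) || (b == 0)); last first.
  move: abN; rewrite negb_or => /andP[a0 b0].
  have a0' : a^* != 0 by rewrite conjC_eq0.
  have b0' : b^* != 0 by rewrite conjC_eq0.
  (* For d nonzero its relation asks for k = d/d^*, which equals a^*/a because ad is real; the
     relation for b then gives l. *)
  pose l := a * b / (a^* * b^*); exists l, (a^* / a).
  have lm : l ^+ m = (a^* / a) ^+ 2.
    rewrite /l 2!expr_div_n; apply/eqP.
    rewrite eqr_div ?expf_neq0 ?mulf_neq0 //; apply/eqP; rewrite !exprMn.
    transitivity (a ^+ m.+2 * b ^+ m); first by rewrite !exprS; ring.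
    by rewrite -PR !exprS; ring.
  split.
  - by rewrite /l fmorph_div !rmorphM /= !conjCK; field; rewrite a0 b0 a0' b0'.
  - by rewrite mulf_neq0 ?invr_eq0.
  - split.
    + by rewrite exprS lm; field.
    + by rewrite /l; field; rewrite a0 a0' b0'.
    + rewrite exprS lm /l.
      transitivity ((b * c) * a^* / (a * b^*)); first by field; rewrite a0 a0' b0'.
      by rewrite -bcR'; field; rewrite a0 b0'.
    + by apply: (mulfI a0); rewrite -adR; field.
have [cd0|cdN] := boolP ((c == 0) || (d == 0)); last first.
  move: cdN; rewrite negb_or => /andP[c0 d0].
  have c0' : c^* != 0 by rewrite conjC_eq0.
  have d0' : d^* != 0 by rewrite conjC_eq0.
  (* Now k is read off the relation for d, and l off the one for b, with b/b^* replaced by c^*/c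
     since bc is real and b may be 0. *)
  pose l := c^* * d^* / (c * d); exists l, (d / d^*).
  have lm : l ^+ m = (d / d^*) ^+ 2.
    rewrite /l 2!expr_div_n; apply/eqP.
    rewrite eqr_div ?expf_neq0 ?mulf_neq0 //; apply/eqP; rewrite !exprMn.
    transitivity (c^* ^+ m * d^* ^+ m.+2); first by rewrite !exprS; ring.
    by rewrite QR !exprS; ring.
  split.
  - by rewrite /l fmorph_div !rmorphM /= !conjCK; field; rewrite c0 d0 c0' d0'.
  - by rewrite mulf_neq0 ?invr_eq0.
  - split.
    + rewrite exprS lm; transitivity (l * d / d^* ^+ 2 * (a * d)); first by field.
      by rewrite -adR; field.
    + apply: (mulIf c0); rewrite -bcR' /l; field; by rewrite c0 d0 d0'.
    + by rewrite exprS lm /l; field; rewrite c0 d0 d0'.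
    + by rewrite divfK.
(* With ab = cd = 0, determinant 1 leaves only a = d = 0 or b = c = 0; eliminating k then prescribes
   l^(m+2) or l^m respectively. *)
have aN : a = 0 -> d = 0.
  by move=> a0; case/orP: cd0 => /eqP // c0; move: D; rewrite a0 c0 mul0r mulr0 subrr
     => /esym/eqP; rewrite oner_eq0.
have bN : b = 0 -> c = 0.
  by move=> b0; case/orP: cd0 => /eqP // d0; move: D; rewrite b0 d0 mul0r mulr0 subrr
     => /esym/eqP; rewrite oner_eq0.
case/orP: ab0 => /eqP e0.
  have d0 := aN e0; have := D; rewrite e0 d0 mul0r sub0r => bc1.
  have b0 : b != 0.
    by apply/eqP => b0; move/eqP: bc1; rewrite b0 mul0r oppr0 eq_sym oner_eq0.
  have c0 : c != 0.
    by apply/eqP => c0; move/eqP: bc1; rewrite c0 mulr0 oppr0 eq_sym oner_eq0.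
  have c0' : c^* != 0 by rewrite conjC_eq0.
  have b0' : b^* != 0 by rewrite conjC_eq0.
  have [|l lE l1] := @unit_root m.+2 (b * c^* / (b^* * c)) isT.
    by rewrite fmorph_div !rmorphM /= !conjCK; field; rewrite c0 b0 c0' b0'.
  have l0 : l != 0.
    by apply/eqP => l0; move/eqP: l1; rewrite l0 mul0r eq_sym oner_eq0.
  exists l, (b / (l * b^*)); split => //; first by rewrite !mulf_neq0 ?invr_eq0 ?mulf_neq0.
  rewrite rmorph0 !mulr0 mul0r; split => //; first by rewrite divfK ?mulf_neq0.
  by apply: (mulfI l0); rewrite mulrCA -exprS lE; field; rewrite l0 b0' c0.
have c0 := bN e0; have := D; rewrite e0 c0 mul0r subr0 => ad1.
have a0 : a != 0.
  by apply/eqP => a0; move/eqP: ad1; rewrite a0 mul0r eq_sym oner_eq0.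
have d0 : d != 0.
  by apply/eqP => d0; move/eqP: ad1; rewrite d0 mulr0 eq_sym oner_eq0.
have a0' : a^* != 0 by rewrite conjC_eq0.
have d0' : d^* != 0 by rewrite conjC_eq0.
have [|l lE l1] := @unit_root m (d * a^* / (d^* * a)) m0.
  by rewrite fmorph_div !rmorphM /= !conjCK; field; rewrite a0 d0 a0' d0'.
exists l, (d / d^*); split => //; first by rewrite mulf_neq0 ?invr_eq0.
rewrite rmorph0 !mulr0 mul0r exprS lE divfK //; split => //.
by field; rewrite d0' a0.
Qed.

(** The relation for d gives k, the one for b gives l, and l is real because ad and bc are; the last
    hypothesis supplies the value of l^m. *)
Lemma anti_exists : a != 0 -> b != 0 -> c != 0 -> d != 0 ->
  a ^+ m.+2 * b ^+ m = c^* ^+ m * d^* ^+ m.+2 ->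
  exists l k, [/\ l != 0, l^* = l, k != 0 &
    [/\ b = k * (l * c^*), a * l ^+ m.+1 = k * (l * d^*),
        d = k * a^* & c * l ^+ m.+1 = k * b^*]].
Proof.
move=> a0 b0 c0 d0 PQ.
have a0' : a^* != 0 by rewrite conjC_eq0.
have b0' : b^* != 0 by rewrite conjC_eq0.
have c0' : c^* != 0 by rewrite conjC_eq0.
have d0' : d^* != 0 by rewrite conjC_eq0.
pose l := a^* * b / (c^* * d); exists l, (d / a^*).
have lm : l ^+ m = d * d^* / (a * a^*).
  rewrite /l expr_div_n !exprMn; apply/eqP.
  rewrite eqr_div ?mulf_neq0 ?expf_neq0 //; apply/eqP.
  (* The extra power of [a] makes a^(m+2) b^m appear, which [PQ] rewrites. *)
  apply: (mulIf (expf_neq0 m.+1 a0)).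
  transitivity (a^* ^+ m.+1 * (a ^+ m.+2 * b ^+ m)); first by rewrite !exprS; ring.
  rewrite PQ; transitivity (c^* ^+ m * d^* * (a^* * d^*) ^+ m.+1).
    by rewrite !exprMn !exprS; ring.
  by rewrite adR !exprMn !exprS; ring.
have lN0 : l != 0 by rewrite !mulf_neq0 ?invr_eq0 ?mulf_neq0.
split => //.
- rewrite /l fmorph_div !rmorphM /= !conjCK; apply/eqP.
  rewrite eqr_div ?mulf_neq0 //; apply/eqP.
  transitivity ((a * d) * (b^* * c^*)); first by ring.
  by rewrite bcR' -adR; ring.
- by rewrite mulf_neq0 ?invr_eq0.
- split.
  + by rewrite /l; field; rewrite a0' c0' d0.
  + by rewrite exprS lm; field; rewrite a0 a0'.
  + by rewrite divfK.
  + rewrite exprS lm /l.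
    transitivity ((b * c) * d^* / (c^* * a)); first by field; rewrite a0 a0' c0' d0.
    rewrite -bcR'; transitivity (b^* * (a^* * d^*) / (a * a^*)).
      by field; rewrite a0 a0' c0'.
    by rewrite adR; field; rewrite a0 a0'.
Qed.

End Existence.

End Invariants.

(** * Transport of symmetries along a bijective conjugacy *)

Section Transport.
Variable T : Type.
Implicit Types (f g h r s : T -> T).

Lemma commutes_comp r s f : commutes r f -> commutes s f -> commutes (r \o s) f.
Proof.
move=> rf sf; apply/funext => x; rewrite /=.
have -> : s (f x) = f (s x) by exact: (congr1 (@^~ x) sf).
exact: (congr1 (@^~ (s x)) rf).
Qed.

Lemma commutes_transport f g h h' r : h' \o h = id -> h \o h' = id ->
  h \o f = g \o h -> commutes r f -> commutes (h \o r \o h') g.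
Proof.
move=> h'h hh' hf rf; apply/funext => x; rewrite /=.
have h'g : h' (g x) = f (h' x).
  rewrite -{1}(congr1 (@^~ x) hh' : h (h' x) = x).
  have <- : h (f (h' x)) = g (h (h' x)) by exact: (congr1 (@^~ (h' x)) hf).
  exact: (congr1 (@^~ (f (h' x))) h'h).
have -> : r (h' (g x)) = f (r (h' x)).
  by rewrite h'g; exact: (congr1 (@^~ (h' x)) rf).
exact: (congr1 (@^~ (r (h' x))) hf).
Qed.

Lemma involution_transport h h' r : h' \o h = id -> h \o h' = id ->
  r \o r = id -> (h \o r \o h') \o (h \o r \o h') = id.
Proof.
move=> h'h hh' rr; apply/funext => x; rewrite /=.
rewrite (congr1 (@^~ _) h'h : h' (h (r (h' x))) = r (h' x)).
rewrite (congr1 (@^~ _) rr : r (r (h' x)) = h' x).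
exact: (congr1 (@^~ x) hh').
Qed.

Lemma transport_id h h' r : h' \o h = id -> h \o h' = id ->
  h \o r \o h' = id -> r = id.
Proof.
move=> h'h hh' E; apply/funext => x.
have h'K y : h' (h y) = y := congr1 (@^~ y) h'h.
by have := congr1 (@^~ (h x)) E; rewrite /= h'K => /(congr1 h'); rewrite !h'K.
Qed.

Lemma semiconj_inv f g h h' : h' \o h = id -> h \o h' = id ->
  h \o f = g \o h -> h' \o g = f \o h'.
Proof.
move=> h'h hh' hf; apply/funext => x; rewrite /=.
rewrite -{1}(congr1 (@^~ x) hh' : h (h' x) = x).
have <- : h (f (h' x)) = g (h (h' x)) by exact: (congr1 (@^~ (h' x)) hf).
exact: (congr1 (@^~ (f (h' x))) h'h).
Qed.

End Transport.

(** * Antiholomorphic and Moebius symmetries of normal forms *)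

Section Commuting.
Variable C : numClosedFieldType.
Implicit Types (a b c d l : C) (n : nat).
Implicit Types (h phi psi alpha beta : sphere C -> sphere C).

Lemma antiholomorphicMl phi alpha : mobius phi -> antiholomorphic alpha ->
  antiholomorphic (phi \o alpha).
Proof.
move=> mphi [psi [mpsi ->]]; exists (phi \o psi); split=> //.
exact: mobius_comp.
Qed.

Lemma antiholomorphicMr phi alpha : mobius phi -> antiholomorphic alpha ->
  antiholomorphic (alpha \o phi).
Proof.
move=> mphi [psi [mpsi ->]]; have [phi' mphi' E] := conj_mobius mphi.
exists (psi \o phi'); split; first exact: mobius_comp.
by apply/funext => z; exact: (congr1 psi (congr1 (@^~ z) E)).
Qed.

Lemma antiholomorphic_comp alpha beta :
  antiholomorphic alpha -> antiholomorphic beta -> mobius (alpha \o beta).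
Proof.
move=> [phi [mphi ->]] [psi [mpsi ->]]; have [psi' mpsi' E] := conj_mobius mpsi.
have -> : (phi \o @conj_sphere C) \o (psi \o @conj_sphere C) = phi \o psi'.
  apply/funext => z; rewrite /=.
  rewrite (congr1 (@^~ (conj_sphere z)) E :
    conj_sphere (psi (conj_sphere z)) = psi' (conj_sphere (conj_sphere z))).
  by rewrite (congr1 (@^~ z) (@conj_sphereK C) : conj_sphere (conj_sphere z) = z).
exact: mobius_comp.
Qed.

Lemma antiholomorphic_involution_transport h h' alpha :
  mobius h -> mobius h' -> h' \o h = id -> h \o h' = id ->
  antiholomorphic_involution alpha ->
  antiholomorphic_involution (h \o alpha \o h').
Proof.
move=> mh mh' h'h hh' [aalpha alpha2]; split; last exact: involution_transport.
by apply: antiholomorphicMr => //; apply: antiholomorphicMl.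
Qed.

(** Moving complex conjugation past the map conjugates its coefficients. This turns an
    antiholomorphic symmetry into a Moebius semiconjugacy, to which [diag_semiconj] and
    [anti_semiconj] apply. *)
Lemma semiconj_commutes n a b c d phi : (0 < n)%N -> a * d - b * c != 0 ->
  phi \o binomial_map n a^* b^* c^* d^* = binomial_map n a b c d \o phi <->
  commutes (phi \o @conj_sphere C) (binomial_map n a b c d).
Proof.
move=> n0 D; have [_ E] := conj_binomial n0 D.
have EE z : conj_sphere (binomial_map n a b c d z) =
    binomial_map n a^* b^* c^* d^* (conj_sphere z) := congr1 (@^~ z) E.
have cK z : conj_sphere (conj_sphere z) = z := congr1 (@^~ z) (@conj_sphereK C).
split=> H; apply/funext => z.
  transitivity (phi (binomial_map n a^* b^* c^* d^* (conj_sphere z))).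
    exact: congr1 (EE z).
  exact: (congr1 (@^~ (conj_sphere z)) H).
transitivity (phi (conj_sphere (binomial_map n a b c d (conj_sphere z)))).
  by rewrite /= EE cK.
transitivity (binomial_map n a b c d (phi (conj_sphere (conj_sphere z)))).
  exact: (congr1 (@^~ (conj_sphere z)) H).
by rewrite cK.
Qed.

Lemma commuting_real n a b c d alpha : (2 <= n)%N -> a * d - b * c != 0 ->
  antiholomorphic_involution alpha -> commutes alpha (binomial_map n a b c d) ->
  paramX a b c d \is Num.real /\ paramY n a b c d \is Num.real.
Proof.
case: n => [//|m] n2 D [[phi [mphi Ealpha]] alphaK] comm.
(* Complex conjugation fixes 0 and infinity, so [phi] moves them as [alpha] does. *)
have ram z : z = pt 0 1 \/ z = pt 1 0 -> phi z = pt 0 1 \/ phi z = pt 1 0.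
  move=> zr; have <- : alpha z = phi z.
    rewrite Ealpha -[LHS]/(phi (conj_sphere z)); congr phi.
    by case: zr => ->; rewrite conj_pt rmorph0 rmorph1.
  exact: (commute_ramified n2 D alphaK alphaK comm zr).
have [D' _] := conj_binomial (ltn0Sn m) D.
rewrite Ealpha in comm; move/(semiconj_commutes phi (ltn0Sn m) D): comm.
have [l l0 [->|->]] := mobius_ramified mphi ram.
  by case/(diag_semiconj (ltn0Sn m) D' D l0) => k k0 /(diag_param_real l0 k0).
by case/(anti_semiconj (ltn0Sn m) D' D l0) => k k0 /(anti_param_real l0 k0).
Qed.

Lemma mobius_diag l : l != 0 -> mobius (diag l).
Proof. by move=> l0; exists l, 0, 0, 1; split; [exact: diag_det_neq0|]. Qed.

Lemma mobius_anti l : l != 0 -> mobius (anti l).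
Proof. by move=> l0; exists 0, l, 1, 0; split; [exact: anti_det_neq0|]. Qed.

Lemma diag_conj_involution l : l * l^* = 1 ->
  antiholomorphic_involution (diag l \o @conj_sphere C).
Proof.
move=> l1; have l0 : l != 0.
  by apply/eqP => l0; move/eqP: l1; rewrite l0 mul0r eq_sym oner_eq0.
split; first by exists (diag l); split; first exact: mobius_diag.
apply/funext => z; have [u [v [uv ->]]] := sphere_ptP z.
have uv' : nz u^* v^* by rewrite nz_conj.
rewrite /= /diag conj_pt (binomial_pt _ (diag_det_neq0 l0) uv') // conj_pt.
rewrite (binomial_pt _ (diag_det_neq0 l0)) //; last first.
  by rewrite nz_conj; have := nz_linear (diag_det_neq0 l0) uv'.
rewrite !expr1 !mul0r !mul1r !addr0 !add0r rmorphM /= !conjCK mulrA l1.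
by rewrite mul1r.
Qed.

Lemma anti_conj_involution l : l != 0 -> l^* = l ->
  antiholomorphic_involution (anti l \o @conj_sphere C).
Proof.
move=> l0 lR; split; first by exists (anti l); split; first exact: mobius_anti.
apply/funext => z; have [u [v [uv ->]]] := sphere_ptP z.
have uv' : nz u^* v^* by rewrite nz_conj.
rewrite /= /anti conj_pt (binomial_pt _ (anti_det_neq0 l0) uv') // conj_pt.
rewrite (binomial_pt _ (anti_det_neq0 l0)) //; last first.
  by rewrite nz_conj; have := nz_linear (anti_det_neq0 l0) uv'.
rewrite !expr1 !mul0r !mul1r !addr0 !add0r rmorphM /= !conjCK lR.
exact: pt_scale.
Qed.

Lemma real_commuting_det1 n a b c d : (2 <= n)%N -> a * d - b * c = 1 ->
  paramX a b c d \is Num.real -> paramY n a b c d \is Num.real ->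
  exists alpha, antiholomorphic_involution alpha /\
    commutes alpha (binomial_map n a b c d).
Proof.
case: n => [//|m] m0 D1; rewrite ltnS in m0.
have D : a * d - b * c != 0 by rewrite D1 oner_neq0.
have [D' _] := conj_binomial (ltn0Sn m) D.
rewrite /paramX /paramY D1 expr1n !divr1 !CrealE => /eqP XR /eqP.
set P := a ^+ m.+2 * b ^+ m; set Q := c ^+ m * d ^+ m.+2 => YR.
have PC : P^* = a^* ^+ m.+2 * b^* ^+ m by rewrite /P rmorphM !rmorphXn.
have QC : Q^* = c^* ^+ m * d^* ^+ m.+2 by rewrite /Q rmorphM !rmorphXn.
(* Since ad = 1 + bc, the product depends on the real number bc alone. *)
have PQ : (P * Q)^* = P * Q.
  have -> : P * Q = (1 + b * c) ^+ m.+2 * (b * c) ^+ m.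
    have -> : 1 + b * c = a * d by rewrite -D1 subrK.
    by rewrite /P /Q !exprMn; ring.
  by rewrite rmorphM !rmorphXn rmorphD rmorph1 /= XR.
(* P and Q are the roots of a quadratic with real coefficients. *)
have PP : P^* = P \/ P^* = Q.
  have /eqP : (P^* - P) * (P^* - Q) = 0.
    have fact (x y z : C) : (x - y) * (x - z) = x * x - x * (y + z) + y * z by ring.
    rewrite fact -YR -PQ (rmorphD _ P) (rmorphM _ P Q) /=.
    by move: (P^*) (Q^*) => x y; ring.
  by rewrite mulf_eq0 !subr_eq0 => /orP[]/eqP; [left|right].
have [PE|PN] := eqVneq P^* P.
  have QE : Q^* = Q by apply: (addrI P); rewrite -{1}PE -rmorphD.
  have [l [k [l1 k0 E]]] := diag_exists m0 D1 XR (etrans (esym PC) PE)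
    (etrans (esym QC) QE).
  have l0 : l != 0.
    by apply/eqP => l0; move/eqP: l1; rewrite l0 mul0r eq_sym oner_eq0.
  exists (diag l \o @conj_sphere C); split; first exact: diag_conj_involution.
  apply/(semiconj_commutes _ (ltn0Sn m) D)/(diag_semiconj (ltn0Sn m) D' D l0).
  by exists k.
case: PP => PE; first by rewrite PE eqxx in PN.
(* A non-real P and its conjugate Q are nonzero, hence so are all four coefficients, as
   [anti_exists] requires. *)
have P0 : P != 0 by apply: contraNneq PN => ->; rewrite rmorph0.
have Q0 : Q != 0 by rewrite -PE conjC_eq0.
have [a0 b0] : a != 0 /\ b != 0.
  by move: P0; rewrite mulf_eq0 !expf_eq0 m0 negb_or => /andP[].
have [c0 d0] : c != 0 /\ d != 0.
  by move: Q0; rewrite mulf_eq0 !expf_eq0 m0 negb_or => /andP[].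
have [|l [k [l0 lR k0 E]]] := @anti_exists _ m a b c d D1 XR a0 b0 c0 d0.
  by rewrite -QC -PE conjCK.
exists (anti l \o @conj_sphere C); split; first exact: anti_conj_involution.
apply/(semiconj_commutes _ (ltn0Sn m) D)/(anti_semiconj (ltn0Sn m) D' D l0).
by exists k.
Qed.

Lemma real_commuting n a b c d : (2 <= n)%N -> a * d - b * c != 0 ->
  paramX a b c d \is Num.real -> paramY n a b c d \is Num.real ->
  exists alpha, antiholomorphic_involution alpha /\
    commutes alpha (binomial_map n a b c d).
Proof.
(* Scaling by [s] makes the determinant 1 without changing the map; X and Y are kept by the case l =
   1 of [param_twist]. *)
case: n => [//|m] m0 D; pose s := (sqrtC (a * d - b * c))^-1.
have s0 : s != 0 by rewrite invr_eq0 sqrtC_eq0.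
have [] := @param_twist _ m s 1 a b c d s0 (oner_neq0 _).
rewrite !expr1n invr1 !mulr1 => <- <-; rewrite -(binomial_mapZ (ltn0Sn m) D s0).
apply: real_commuting_det1 => //.
have -> : s * a * (s * d) - s * b * (s * c) = s ^+ 2 * (a * d - b * c) by ring.
by rewrite /s exprVn sqrtCK mulVf.
Qed.

(** A symmetry l/z is already an involution. A symmetry lz only forces a special form of the map,
    for which some mu/z is also a symmetry. *)
Lemma commuting_involution n a b c d phi : (2 <= n)%N -> a * d - b * c != 0 ->
  mobius phi -> phi <> id -> commutes phi (binomial_map n a b c d) ->
  exists psi, [/\ mobius psi, psi <> id, psi \o psi = id &
    commutes psi (binomial_map n a b c d)].
Proof.
case: n => [//|m] n2 D mphi phiN comm; have m0 : (0 < m)%N by rewrite ltnS in n2.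
have anti_inv l : l != 0 -> commutes (anti l) (binomial_map m.+1 a b c d) ->
    exists psi, [/\ mobius psi, psi <> id, psi \o psi = id &
      commutes psi (binomial_map m.+1 a b c d)].
  move=> l0 cl; exists (anti l); split => //; first exact: mobius_anti.
    rewrite -binomial_id.
    case/(binomial_map_inj (ltn0Sn 0) (anti_det_neq0 l0) (id_det_neq0 C)).
    by move=> k _ [/eqP]; rewrite mulr0 oner_eq0.
  rewrite binomial_comp ?anti_det_neq0 // !mul0r !mulr0 !mulr1 !mul1r !addr0 !add0r.
  rewrite -binomial_id -(@binomial_mapZ _ 1 l 1 0 0 1) ?id_det_neq0 //.
  by rewrite !mulr1 !mulr0.
have [phi' [_ phiK phiK']] := mobius_inv mphi.
have ram z := @commute_ramified _ m.+1 a b c d phi phi' z n2 D phiK phiK' comm.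
have [l l0 [E|E]] := mobius_ramified mphi ram; last first.
  by apply: (anti_inv l l0); rewrite -E.
have l1 : l != 1 by apply/eqP => l1; apply: phiN; rewrite E l1; exact: binomial_id.
move: comm; rewrite E => /(diag_semiconj (ltn0Sn m) D D l0)[k k0 [Ea Eb Ec Ed]].
have fixed x : x = l * x -> x = 0.
  move=> /eqP; rewrite -subr_eq0 -{1}[x]mul1r -mulrBl mulf_eq0 subr_eq0.
  by rewrite eq_sym (negPf l1) => /eqP.
(* The case d = 0 leads to the form b/z^n; otherwise k = 1, which leads to az^n. *)
have [d0|d0] := eqVneq d 0.
  have [b0 c0] : b != 0 /\ c != 0.
    move: D; rewrite d0 mulr0 sub0r oppr_eq0 mulf_eq0 negb_or.
    by move/andP.
  have kl : k * l = 1 by apply: (mulIf b0); rewrite mul1r -mulrA -Eb.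
  have lk : l ^+ m.+1 = k by apply: (mulfI c0); rewrite Ec mulrC.
  have a0 : a = 0.
    by apply: fixed; apply: (mulIf k0); rewrite -{1}lk Ea mulrC.
  (* With a = d = 0, eliminating k from the relations for [anti mu] leaves mu^(m+2) = (b/c)^2. *)
  pose mu := m.+2.-root ((b / c) ^+ 2).
  have mu0 : mu != 0.
    by rewrite rootC_eq0 // expf_neq0 // mulf_neq0 ?invr_eq0.
  apply: (anti_inv mu mu0); apply/(anti_semiconj (ltn0Sn m) D D mu0).
  exists (b / (mu * c)); first by rewrite !mulf_neq0 ?invr_eq0 ?mulf_neq0.
  split; rewrite ?a0 ?d0 ?mul0r ?mulr0 //; first by rewrite divfK ?mulf_neq0.
  apply: (mulfI mu0); rewrite mulrCA -exprS rootCK //.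
  by field; rewrite ?mu0 ?c0.
have k1 : k = 1 by apply: (mulIf d0); rewrite mul1r -Ed.
rewrite {}k1 !mul1r {k k0 Ed} in Ea Eb Ec.
have b0 := fixed b Eb.
have a0 : a != 0 by apply: contraNneq D => ->; rewrite b0 !mul0r subrr.
have c0 : c = 0.
  apply: fixed; rewrite -{1}Ec -[l ^+ _](mulfK a0) [l ^+ _ * a]mulrC Ea.
  by rewrite mulfK // mulrC.
(* With b = c = 0 the same elimination leaves mu^m = (d/a)^2, solvable as m > 0. *)
pose mu := m.-root ((d / a) ^+ 2).
have mu0 : mu != 0.
  by rewrite rootC_eq0 // expf_neq0 // mulf_neq0 ?invr_eq0.
apply: (anti_inv mu mu0); apply/(anti_semiconj (ltn0Sn m) D D mu0).
exists (d / a); first by rewrite mulf_neq0 ?invr_eq0.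
split; rewrite ?b0 ?c0 ?mul0r ?mulr0 ?divfK //.
by rewrite exprS rootCK //; field.
Qed.

End Commuting.

(** * The symmetry locus and uniqueness of the involution *)

Section Conclusion.
Variable C : numClosedFieldType.
Implicit Types (f phi psi alpha beta : sphere C -> sphere C) (n : nat).

Lemma conj_class_refl f : conj_class f f.
Proof. by exists id; split; first exact: mobius_id. Qed.

(** The locus provides a symmetry of some map [f1] with the same class; reflexivity puts [f] in the
    class of [f1], and the symmetry is transported. *)
Lemma symmetry_locus_commutes n f : symmetry_locus n (conj_class f) ->
  exists phi, [/\ mobius phi, phi <> id & commutes phi f].
Proof.
move=> [f1 [_ Ef [phi [mphi phiN comm]]]].
have : conj_class f1 f by rewrite -Ef; exact: conj_class_refl.
move=> [h [mh hf]]; have [h' [mh' hh' h'h]] := mobius_inv mh.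
exists (h \o phi \o h'); split.
- by apply: mobius_comp => //; apply: mobius_comp.
- by move/(transport_id h'h hh').
- exact: (commutes_transport h'h hh' hf comm).
Qed.

Lemma commuting_involution_normal_form n f : (2 <= n)%N ->
  (normal_forms n f !=set0)%classic ->
  forall phi, mobius phi -> phi <> id -> commutes phi f ->
  exists psi, [/\ mobius psi, psi <> id, psi \o psi = id & commutes psi f].
Proof.
move=> n2 [[[[a b] c] d] [D [h [mh hf]]]] phi mphi phiN comm.
have [h' [mh' hh' h'h]] := mobius_inv mh.
have [||psi [mpsi psiN psi2 pcomm]] :=
  commuting_involution n2 D _ _ (commutes_transport h'h hh' hf comm).
- by apply: mobius_comp => //; apply: mobius_comp.
- by move/(transport_id h'h hh').
exists (h' \o psi \o h); split.
- by apply: mobius_comp => //; apply: mobius_comp.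
- by move/(transport_id hh' h'h).
- exact: involution_transport.
- exact: (commutes_transport hh' h'h (semiconj_inv h'h hh' hf) pcomm).
Qed.

Lemma unique_antiholomorphic_involution n f alpha : (2 <= n)%N ->
  bicritical n f ->
  antiholomorphic_involution alpha -> commutes alpha f ->
  (forall beta, antiholomorphic_involution beta -> commutes beta f ->
     beta = alpha) <-> ~ symmetry_locus n (conj_class f).
Proof.
move=> n2 hf [aalpha alpha2] acomm.
have alphaK z : alpha (alpha z) = z := congr1 (@^~ z) alpha2.
split=> [uniq /symmetry_locus_commutes[phi [mphi phiN comm]]|asym beta].
  have [psi [mpsi psiN psi2 pcomm]] := commuting_involution_normal_form n2
    (bicritical_normal_form n2 hf) mphi phiN comm.
  have psiK z : psi (psi z) = z := congr1 (@^~ z) psi2.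
  (* The left side is a conjugate of [alpha] by a symmetry of f, so uniqueness applies and [psi]
     commutes with [alpha]. *)
  have Ealpha : psi \o alpha \o psi = alpha.
    apply: uniq; last by apply: commutes_comp => //; exact: commutes_comp.
    exact: antiholomorphic_involution_transport.
  have EalphaK z : psi (alpha (psi z)) = alpha z := congr1 (@^~ z) Ealpha.
  (* Because the two commute, their product is an antiholomorphic involution as well, and uniqueness
     applies again. *)
  apply: psiN; have : alpha \o psi = alpha.
    apply: uniq; last exact: commutes_comp.
    split; first exact: antiholomorphicMr.
    by apply/funext => z; rewrite /= EalphaK alphaK.
  move=> E; apply/funext => z; have Ez : alpha (psi z) = alpha z := congr1 (@^~ z) E.
  by rewrite -[LHS]alphaK Ez alphaK.
(* A second involution [beta] yields the Moebius symmetry [beta \o alpha], which is the identity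
   only if [beta] is [alpha]. *)
move=> [abeta beta2] bcomm; apply: contrapT => betaN; apply: asym.
exists f; split => //; exists (beta \o alpha); split.
- exact: antiholomorphic_comp.
- move=> E; apply: betaN; apply/funext => z.
  by rewrite -{1}[z]alphaK; exact: (congr1 (@^~ (alpha z)) E).
- exact: commutes_comp.
Qed.

Lemma real_invariants_commuting n f : (2 <= n)%N -> bicritical n f ->
  (invX n f \is Num.real /\ invY n f \is Num.real) <->
  exists alpha, antiholomorphic_involution alpha /\ commutes alpha f.
Proof.
(* Existence of a normal form ensures that [xget] picks a genuine one rather than its default; the
   argument applies to whichever is picked. *)
move=> n2 hf; have : normal_forms n f (normal_coeffs n f).
  exact: (xgetPex _ (bicritical_normal_form n2 hf)).
rewrite /invX /invY; case: (normal_coeffs n f) => -[[a b] c] d.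
move=> [D [h [mh hf']]]; have [h' [mh' hh' h'h]] := mobius_inv mh.
split=> [[XR YR]|[alpha [ialpha comm]]].
  have [alpha [ialpha comm]] := real_commuting n2 D XR YR.
  exists (h' \o alpha \o h); split.
    exact: antiholomorphic_involution_transport.
  exact: (commutes_transport hh' h'h (semiconj_inv h'h hh' hf') comm).
apply: (@commuting_real _ n a b c d (h \o alpha \o h')) => //.
  exact: antiholomorphic_involution_transport.
exact: (commutes_transport h'h hh' hf' comm).
Qed.

End Conclusion.

Theorem lemma5p1 (R : realType) (n : nat) (f : sphere R[i] -> sphere R[i])
    (hn : (2 <= n)%N) (hf : bicritical n f) :
  ((invX n f \is Num.real /\ invY n f \is Num.real) <->
   (exists alpha : sphere R[i] -> sphere R[i],
      antiholomorphic_involution alpha /\ commutes alpha f)) /\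
  (forall alpha : sphere R[i] -> sphere R[i],
     antiholomorphic_involution alpha -> commutes alpha f ->
     ((forall beta : sphere R[i] -> sphere R[i],
         antiholomorphic_involution beta -> commutes beta f -> beta = alpha) <->
      ~ symmetry_locus n (conj_class f))).
Proof.
split; first exact: real_invariants_commuting.
by move=> alpha; exact: unique_antiholomorphic_involution.
Qed.
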